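(* Let $\mathcal{G}$ be a second countable, locally compact, Hausdorff, étale groupoid. If $C^*_{\mathrm{red}}(\mathcal{G})$ is simple, and there is a unit $u_0\in\mathcal{G}^{(0)}$ such that the group $\mathrm{IntIso}(\mathcal{G})u_0$ is amenable, then $\mathrm{IntIso}(\mathcal{G})u=\{e\}$ (the trivial group) for all $u\in\mathcal{G}^{(0)}$.
   Context: Ideals are closed and two-sided; a $C^*$-algebra is simple if it has no ideals other than $\{0\}$ and itself. A groupoid is étale if its range and source maps $r,s$ are local homeomorphisms. $\mathcal{G}^{(0)}$ is the unit space. $C_c(\mathcal{G})$ is a $*$-algebra under $(f\times g)(\gamma)=\sum_{\alpha\beta=\gamma}f(\alpha)g(\beta)$ and $f^*(\gamma)=\overline{f(\gamma^{-1})}$; $C^*(\mathcal{G})$ is its completion in the full norm $\|f\|_{\mathrm{full}}=\sup_\pi\|\pi(f)\|$ over all $*$-representations $\pi$ on Hilbert spaces. Restriction of functions to $\mathcal{G}^{(0)}$ extends to a conditional expectation $\mathbb{E}:C^*(\mathcal{G})\to C_0(\mathcal{G}^{(0)})$, and $C^*_{\mathrm{red}}(\mathcal{G})=C^*(\mathcal{G})/K_{\mathbb{E}}$, where $K_{\mathbb{E}}=\{a:\mathbb{E}(xay)=0\ \forall x,y\}$. $\mathrm{IntIso}(\mathcal{G})$ is the interior in $\mathcal{G}$ of $\mathrm{Iso}(\mathcal{G})=\{\gamma\in\mathcal{G}:r(\gamma)=s(\gamma)\}$. For $u\in\mathcal{G}^{(0)}$, $\mathrm{IntIso}(\mathcal{G})u=\mathrm{IntIso}(\mathcal{G})\cap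 s^{-1}(u)$, which is a countable discrete group. *)

(* Defs.v *)
From HB Require Import structures.
From mathcomp Require Import all_boot all_order all_algebra.
From mathcomp Require Import complex.
From mathcomp Require Import all_classical all_reals all_analysis.

Set Implicit Arguments.
Unset Strict Implicit.
Unset Printing Implicit Defensive.

Import Order.TTheory GRing.Theory Num.Theory.
Import numFieldNormedType.Exports.

Local Open Scope classical_set_scope.
Local Open Scope ring_scope.

(* The complex numbers R[i] with their usual topology. *)
Notation cplx R := (R[i] : numFieldType).

(* In a normed module over R[i] the norm `|x| is an element of R[i] (with zero
   imaginary part); rnorm is the same number as an element of R. *)
Definition rnorm (R : realType) (V : normedModType R[i]) (x : V) : R :=
  complex.Re `|x|.

(** * Étale groupoids *)

(* A topological groupoid with space of arrows garr and space of units gobj.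
   The unit space is identified with its image under gunit, which is
   automatically a homeomorphism onto that image since gsrc \o gunit = id.
   The product gmul x y is meaningful when gsrc x = grng y; other values of
   gmul are unconstrained. *)
Record groupoid := Groupoid {
  garr :> topologicalType;
  gobj : topologicalType;
  gsrc : garr -> gobj;
  grng : garr -> gobj;
  gunit : gobj -> garr;
  gmul : garr -> garr -> garr;
  ginv : garr -> garr;
  gsrc_unit : forall u, gsrc (gunit u) = u;
  grng_unit : forall u, grng (gunit u) = u;
  gsrc_mul : forall x y, gsrc x = grng y -> gsrc (gmul x y) = gsrc y;
  grng_mul : forall x y, gsrc x = grng y -> grng (gmul x y) = grng x;
  gmulA : forall x y z, gsrc x = grng y -> gsrc y = grng z ->
    gmul x (gmul y z) = gmul (gmul x y) z;
  gmul_unit : forall x, gmul x (gunit (gsrc x)) = x;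
  gunit_mul : forall x, gmul (gunit (grng x)) x = x;
  gsrc_inv : forall x, gsrc (ginv x) = grng x;
  grng_inv : forall x, grng (ginv x) = gsrc x;
  gmul_inv : forall x, gmul x (ginv x) = gunit (grng x);
  ginv_mul : forall x, gmul (ginv x) x = gunit (gsrc x);
  gsrc_continuous : continuous gsrc;
  grng_continuous : continuous grng;
  gunit_continuous : continuous gunit;
  ginv_continuous : continuous ginv;
  gmul_continuous :
    {within [set p : garr * garr | gsrc p.1 = grng p.2],
      continuous (fun p => gmul p.1 p.2)} }.

Definition local_homeomorphism (X Y : topologicalType) (f : X -> Y) : Prop :=
  forall x, exists (U : set X) (g : Y -> X),
    [/\ open U, U x, open (f @` U), {within U, continuous f} &
        {within f @` U, continuous g} /\ (forall y, U y -> g (f y) = y)].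

Definition etale (G : groupoid) : Prop :=
  local_homeomorphism (@grng G) /\ local_homeomorphism (@gsrc G).

Definition Iso (G : groupoid) : set G := [set x | grng x = gsrc x].

Definition IntIso (G : groupoid) : set G := interior (@Iso G).

Definition IntIso_at (G : groupoid) (u : gobj G) : set G :=
  [set x | IntIso x /\ gsrc x = u].

(* S is meant to be a subgroup of an isotropy group of G, with the discrete
   topology: amenability is the existence of a left-invariant mean m on the
   bounded functions S -> R.  Here m is applied to functions on all of G, but
   linearity and positivity force m f to depend only on the restriction of f
   to S. *)
Definition amenable_isotropy (R : realType) (G : groupoid) (S : set G) : Prop :=
  exists m : (G -> R) -> R,
    [/\ forall (a : R) (f g : G -> R),
          [bounded f x | x in S] -> [bounded g x | x in S] ->
          m (fun x => a * f x + g x) = a * m f + m g,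
        forall f : G -> R, [bounded f x | x in S] ->
          (forall x, S x -> 0 <= f x) -> 0 <= m f,
        m (fun=> 1) = 1 &
        forall (h : G) (f : G -> R), S h -> [bounded f x | x in S] ->
          m (fun x => f (gmul h x)) = m f].

(** * C*-algebras and Hilbert spaces *)

(* Not assumed unital. *)
Record cstarAlgebra (R : realType) := CstarAlgebra {
  cs_space :> completeNormedModType R[i];
  cs_mul : cs_space -> cs_space -> cs_space;
  cs_star : cs_space -> cs_space;
  cs_mulA : associative cs_mul;
  cs_mulDl : left_distributive cs_mul +%R;
  cs_mulDr : right_distributive cs_mul +%R;
  cs_mulZl : forall (a : R[i]) x y, cs_mul (a *: x) y = a *: cs_mul x y;
  cs_mulZr : forall (a : R[i]) x y, cs_mul x (a *: y) = a *: cs_mul x y;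
  cs_starK : involutive cs_star;
  cs_starD : {morph cs_star : x y / x + y};
  cs_starZ : forall (a : R[i]) x, cs_star (a *: x) = a^* *: cs_star x;
  cs_starM : forall x y, cs_star (cs_mul x y) = cs_mul (cs_star y) (cs_star x);
  cs_normM : forall x y, `|cs_mul x y| <= `|x| * `|y|;
  cs_normC : forall x, `|cs_mul (cs_star x) x| = `|x| ^+ 2 }.

Definition closed_ideal (R : realType) (A : cstarAlgebra R) (J : set A) : Prop :=
  [/\ closed J, J 0,
      forall x y, J x -> J y -> J (x + y),
      forall (c : R[i]) x, J x -> J (c *: x) &
      forall a x, J x -> J (cs_mul a x) /\ J (cs_mul x a)].

Definition simple_cstar (R : realType) (A : cstarAlgebra R) : Prop :=
  forall J : set A, closed_ideal J -> J = [set 0] \/ J = setT.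

Record hilbertSpace (R : realType) := HilbertSpace {
  hs_space :> completeNormedModType R[i];
  hs_dot : {dot hs_space for (Num.conj : R[i] -> R[i])};
  hs_normE : forall x : hs_space, `|x| ^+ 2 = hs_dot x x }.

Definition opnorm (R : realType) (V W : normedModType R[i]) (T : V -> W) :
    \bar R :=
  ereal_sup [set (rnorm (T x))%:E | x in [set x : V | `|x| <= 1]].

(** * Groupoid C*-algebras *)

Definition Cc (R : realType) (X : topologicalType) : set (X -> cplx R) :=
  [set f | continuous f /\ compact (closure [set x | f x != 0])].

Definition C0 (R : realType) (X : topologicalType) : set (X -> cplx R) :=
  [set f | continuous f /\
     forall e : R, 0 < e -> exists2 K : set X,
       compact K & forall x, ~ K x -> (complex.Re `|f x|) < e].

(* For f and g in Cc over an étale groupoid the sum has finitely many nonzero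
   terms (otherwise \sum_(_ \in _) would be 0 by convention). *)
Definition conv (R : realType) (G : groupoid) (f g : G -> cplx R) : G -> cplx R :=
  fun x => \sum_(p \in [set p : G * G |
                   gsrc p.1 = grng p.2 /\ gmul p.1 p.2 = x]) (f p.1 * g p.2).

Definition invol (R : realType) (G : groupoid) (f : G -> cplx R) : G -> cplx R :=
  fun x => (f (ginv x))^*.

(* Maps out of Cc(G) are represented by functions defined on all of
   G -> R[i], whose values outside Cc are unconstrained. *)
Definition star_rep (R : realType) (G : groupoid) (H : hilbertSpace R)
    (pi : (G -> cplx R) -> H -> H) : Prop :=
  [/\ forall f, Cc f -> continuous (pi f) /\
        (forall (c : R[i]) x y, pi f (c *: x + y) = c *: pi f x + pi f y),
      forall (c : R[i]) f g x, Cc f -> Cc g ->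
        pi (fun t => c * f t + g t) x = c *: pi f x + pi g x,
      forall f g x, Cc f -> Cc g -> pi (conv f g) x = pi f (pi g x) &
      forall f x y, Cc f -> hs_dot H (pi (invol f) x) y = hs_dot H x (pi f y)].

Definition full_norm (R : realType) (G : groupoid) (f : G -> cplx R) : \bar R :=
  ereal_sup [set t | exists (H : hilbertSpace R) (pi : (G -> cplx R) -> H -> H),
                       star_rep pi /\ t = opnorm (pi f)].

(* (A, j) is the completion of the *-algebra Cc(G) in the full norm; this
   determines it up to isometric *-isomorphism compatible with j. *)
Definition is_full_cstar (R : realType) (G : groupoid) (A : cstarAlgebra R)
    (j : (G -> cplx R) -> A) : Prop :=
  [/\ forall (c : R[i]) f g, Cc f -> Cc g ->
        j (fun t => c * f t + g t) = c *: j f + j g,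
      forall f g, Cc f -> Cc g -> j (conv f g) = cs_mul (j f) (j g),
      forall f, Cc f -> j (invol f) = cs_star (j f),
      forall f, Cc f -> (rnorm (j f))%:E = full_norm f &
      dense (j @` @Cc R G)].

(* E is the conditional expectation onto C0 of the unit space; it is determined
   by being a contractive linear extension of the restriction map on the dense
   subalgebra Cc(G). *)
Definition is_cond_exp (R : realType) (G : groupoid) (A : cstarAlgebra R)
    (j : (G -> cplx R) -> A) (E : A -> gobj G -> cplx R) : Prop :=
  [/\ forall a, C0 (E a),
      forall (c : R[i]) a b u, E (c *: a + b) u = c * E a u + E b u,
      forall a u, `|E a u| <= `|a| &
      forall f, Cc f -> E (j f) = f \o @gunit G].

Definition cond_exp_ideal (R : realType) (G : groupoid) (A : cstarAlgebra R)
    (E : A -> gobj G -> cplx R) : set A :=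
  [set a | forall x y, E (cs_mul (cs_mul x a) y) = fun=> 0].

(* (B, q) is the quotient C*-algebra A / K with its quotient norm. *)
Definition is_cstar_quotient (R : realType) (A : cstarAlgebra R) (K : set A)
    (B : cstarAlgebra R) (q : A -> B) : Prop :=
  [/\ [/\ forall (c : R[i]) a b, q (c *: a + b) = c *: q a + q b,
          forall a b, q (cs_mul a b) = cs_mul (q a) (q b) &
          forall a, q (cs_star a) = cs_star (q a)],
      set_surj setT setT q,
      [set a | q a = 0] = K &
      forall a, rnorm (q a) = inf [set rnorm (a + k) | k in K]].

(* (B, q) is C*_red(G) = C*(G) / K_E, with q : A -> B the quotient map from a
   realisation (A, j) of C*(G). *)
Definition is_reduced_cstar (R : realType) (G : groupoid) (A : cstarAlgebra R)
    (j : (G -> cplx R) -> A) (E : A -> gobj G -> cplx R)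
    (B : cstarAlgebra R) (q : A -> B) : Prop :=
  [/\ is_full_cstar j, is_cond_exp j E &
      is_cstar_quotient (cond_exp_ideal E) q].

(* Main.v *)
(** Suppose [IntIso G] contains some [x] that is not a unit.  Summation over the
    group [S = IntIso_at u0] is the vector functional of the representation of
    [Cc G] on the functions on [s^-1(u0)] that are constant on the left cosets
    of [S].  As [S] is amenable, this representation is weakly contained in the
    regular one: if [xi] is an almost invariant unit vector of l^2(S) (Reiter,
    Namioka), lifted to [X] in [Cc G], then the compressions
    [E (X^* f X) u0] are bounded by the norm of [f] modulo [K_E] and approximate
    [\sum_(x in S) f x].  So the kernel of the representation yields a proper
    closed ideal of the reduced algebra.  If [n] is a bump function on a
    bisection inside [IntIso G] through [x], then [|n|^2 - n^* n] lies in this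
    ideal, since right translation by elements of [IntIso G] is invisible
    modulo [S]; and it is not zero, because [n^* n] is supported on the units.

    No Hilbert space is needed: for a positive functional [om], the inequality
    [|om (x^* a x)| <= |a| om (x^* x)] follows from
    [2 |om (x^* a x)| <= om (x^* x) + om (x^* a^* a x)] by iteration. *)
Require Import Defs.
From HB Require Import structures.
From mathcomp Require Import finmap.
From mathcomp Require Import all_boot all_order all_algebra.
From mathcomp Require Import complex.
From mathcomp Require Import all_classical all_reals all_analysis.
From mathcomp Require Import ring lra.
Import Order.TTheory GRing.Theory Num.Theory.
Import numFieldNormedType.Exports.
Local Open Scope classical_set_scope.
Local Open Scope ring_scope.

Set Implicit Arguments.
Unset Strict Implicit.
Unset Printing Implicit Defensive.

Local Notation conv := Defs.conv.

(** * Positive functionals on C*-algebras *)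

Lemma ger0_cplxP (R : rcfType) (z : R[i]) :
  0 <= z -> exists2 r : R, 0 <= r & z = r%:C%C.
Proof. by case: z => a b; rewrite lecE /= => /andP[/eqP -> a0]; exists a. Qed.

Lemma lec_addgt0P (R : rcfType) (x y : R[i]) :
  (forall e : R, 0 < e -> x <= y + e%:C%C) -> x <= y.
Proof.
case: x y => [a b] [c d] xy; have := xy 1 ltr01.
rewrite !lecE /= addr0 => /andP[-> _] /=.
by apply/ler_addgt0Pr => e /xy; rewrite lecE /= => /andP[].
Qed.

(** Since [2 ^+ n] exceeds [n], a large enough [n] makes the error smaller than any given [e]. *)
Lemma ler_half_iter (R : realType) (k C x : R) :
  (forall n, x <= k + C / 2 ^+ n) -> x <= k.
Proof.
move=> xk; apply/ler_addgt0Pr => e e0.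
have [C0|C0] := leP C 0; first by have := xk 0%N; rewrite expr0 divr1; lra.
have := xk (Num.bound (C / e)); set n := Num.bound _ => xn.
apply: (le_trans xn); rewrite lerD2l ler_pdivrMr ?exprn_gt0//.
have : C / e < n%:R by rewrite archi_boundP// divr_ge0// ltW.
rewrite ltr_pdivrMr// => /ltW /le_trans; apply.
by rewrite mulrC ler_pM2l// -natrX ler_nat ltnW// ltn_expl.
Qed.

(** Positive elements of [R[i]] are real, so closedness of the positive half-line takes a bound on
    the imaginary part as well as on the real part. *)
Lemma ge0c_approx (R : rcfType) (z : R[i]) :
  (forall e : R, 0 < e -> exists2 w : R[i], 0 <= w & `|z - w| <= e%:C%C) -> 0 <= z.
Proof.
move=> H; rewrite lecE /=; apply/andP; split; last first.
  apply/ler_addgt0Pr => e /H [w /ger0_cplxP[r r0 ->]] h.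
  have := le_trans (normc_ge_Re _) h; rewrite lecR; case: z {h H} => a b /=.
  by move=> /ler_normlP; case; lra.
rewrite -[X in _ == X]/(0 : R) -normr_le0; apply/ler_addgt0Pr => e /H [w /ger0_cplxP[r r0 ->]] h.
have : `|complex.Im (z - r%:C%C)|%:C%C <= `|(z - r%:C%C) * 'i%C|.
  by have := normc_ge_Re ((z - r%:C%C) * 'i%C); rewrite ReiNIm normrN.
rewrite normrM [X in _ * X](_ : _ = 1) ?mulr1; last first.
  by rewrite normc_def /= expr0n expr1n /= add0r sqrtr1.
move=> /le_trans /(_ h); rewrite lecR; case: z {h H} => a b /=.
by rewrite /= oppr0 addr0 add0r.
Qed.

Section PositiveFunctional.
Variables (R : realType) (A : cstarAlgebra R) (om : A -> R[i]).
Hypothesis om_lin : forall (c : R[i]) a b, om (c *: a + b) = c * om a + om b.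
Hypothesis om_le : forall a, `|om a| <= `|a|.
Hypothesis om_ge0 : forall b, 0 <= om (cs_mul (cs_star b) b).

Let omD a b : om (a + b) = om a + om b.
Proof. by rewrite -{1}[a]scale1r om_lin mul1r. Qed.

Let om0 : om 0 = 0.
Proof. by apply: (addIr (om 0)); rewrite -omD !add0r. Qed.

Let omZ c a : om (c *: a) = c * om a.
Proof. by rewrite -{1}[c *: a]addr0 om_lin om0 addr0. Qed.

(** Polarization: positivity at [x + c *: y] forces [c * p + c^* * r] to be real for every [c], and
    the cases [c = 1] and [c = 'i] together give [r = p^*]. *)
Lemma om_herm x y :
  om (cs_mul (cs_star y) x) = (om (cs_mul (cs_star x) y))^*.
Proof.
set p := om (cs_mul (cs_star x) y); set r := om _.
have key (c : R[i]) : 0 <= om (cs_mul (cs_star x) x) + c * p + c^* * r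
    + c * c^* * om (cs_mul (cs_star y) y).
  have := om_ge0 (x + c *: y).
  rewrite cs_starD cs_starZ cs_mulDl !cs_mulDr !cs_mulZl !cs_mulZr !omD !omZ.
  by rewrite /p /r; set u := om _; set v := om _; congr (0 <= _); ring.
have kk c : (c * p + c^* * r)^* = c * p + c^* * r.
  have := geC0_conj (key c); rewrite !(rmorphD, rmorphM) /= !conjCK.
  rewrite (geC0_conj (om_ge0 x)) (geC0_conj (om_ge0 y)) => h.
  by move: h; rewrite [c^* * c]mulrC => /addIr; rewrite -!addrA => /addrI.
have h1 := kk 1; have h2 := kk 'i.
move: h1 h2; rewrite conjCi conjC1 !mul1r mulNr rmorphB rmorphD !rmorphM /= conjCi.
move=> h1; have -> : - 'i * p^* - - 'i * r^* = 'i * (r^* - p^*) by ring.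
rewrite -mulrBr => /(mulfI (neq0Ci _)) h2.
rewrite -[r]conjCK; congr (_^*).
have /(mulfI _) : 2 * r^* = 2 * p; last by apply; rewrite pnatr_eq0.
have -> : 2 * r^* = (p^* + r^*) + (r^* - p^*) by ring.
by rewrite h1 h2; ring.
Qed.

Let psi x a := om (cs_mul (cs_star x) (cs_mul a x)).

(** Expand the positive number [om] of [y^* y] for [y = x - c a x], where the phase [c] is chosen
    with [c * z = |z|]. *)
Lemma psi_half x a : `|psi x a| *+ 2 <= psi x (cs_mul (cs_star a) a) + om (cs_mul (cs_star x) x).
Proof.
set z := psi x a.
have [c c1 cz] : exists2 c : R[i], c^* * c = 1 & c * z = `|z|.
  have [->|z0] := eqVneq z 0; first by exists 1; rewrite ?conjC1 ?mulr1 ?normr0 ?mulr0.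
  have nz : `|z| != 0 by rewrite normr_eq0.
  exists (z^* / `|z|).
    rewrite rmorphM /= conjCK fmorphV /= (geC0_conj (normr_ge0 _)).
    by rewrite mulrACA -normCK -expr2 exprVn divff// expf_neq0.
  by rewrite mulrAC [z^* * z]mulrC -normCK expr2 mulfK.
have := om_ge0 (x - c *: cs_mul a x).
rewrite -scaleN1r scalerA mulN1r.
rewrite cs_starD cs_starZ cs_mulDl !cs_mulDr !cs_mulZl !cs_mulZr !omD !omZ.
rewrite [om (cs_mul (cs_star (cs_mul a x)) x)]om_herm -/(psi x a) -/z.
rewrite cs_starM -cs_mulA [cs_mul (cs_star a) _]cs_mulA -/(psi x (cs_mul (cs_star a) a)).
have -> : (- c)^* * z^* = - `|z|.
  by rewrite rmorphN /= mulNr -rmorphM /= cz (geC0_conj (normr_ge0 _)).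
rewrite mulNr cz mulrA rmorphN /= mulrNN [c^* * c]c1 mul1r => h.
rewrite -subr_ge0; by rewrite (le_trans h)// le_eqVlt; apply/orP; left; apply/eqP; ring.
Qed.

(** The start is the crude norm bound. The induction hypothesis is applied to [a^* a], again of norm
    at most 1, and [psi_half] halves the error term. *)
Lemma psi_le_half x a n : `|a| <= 1 -> `|psi x a| <=
  om (cs_mul (cs_star x) x) + `|cs_star x| * `|x| / 2 ^+ n.
Proof.
elim: n a => [|n IH] a a1.
  rewrite expr0 divr1 (le_trans (om_le _))// (le_trans (cs_normM _ _))//.
  rewrite -[leLHS]add0r lerD// ler_wpM2l//.
  by rewrite (le_trans (cs_normM _ _))// -[leRHS]mul1r ler_wpM2r.
have := IH (cs_mul (cs_star a) a).
rewrite cs_normC exprn_ile1// => /(_ isT) h.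
rewrite -(@ler_pMn2r _ 2)// (le_trans (psi_half _ _))//.
have -> : psi x (cs_mul (cs_star a) a) = `|psi x (cs_mul (cs_star a) a)|.
  rewrite ger0_norm// /psi -cs_mulA cs_mulA -cs_starM; exact: om_ge0.
rewrite (le_trans (lerD h (lexx _)))// le_eqVlt; apply/orP; left; apply/eqP.
by rewrite exprS; field.
Qed.

Lemma psi_le x a : `|psi x a| <= `|a| * om (cs_mul (cs_star x) x).
Proof.
have [->|a0] := eqVneq a 0.
  by rewrite /psi -(scale0r 0) cs_mulZl cs_mulZr omZ mul0r !scale0r !normr0 mul0r.
have na : 0 < `|a| by rewrite normr_gt0.
rewrite -ler_pdivrMl//.
have -> : `|a|^-1 * `|psi x a| = `|psi x (`|a|^-1 *: a)|.
  by rewrite /psi cs_mulZl cs_mulZr omZ normrM normfV normr_id.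
have := @psi_le_half x (`|a|^-1 *: a).
have [k k0 ->] := ger0_cplxP (om_ge0 x).
have [C C0 ->] := ger0_cplxP (mulr_ge0 (normr_ge0 (cs_star x)) (normr_ge0 x)).
have [r r0 ->] := ger0_cplxP (normr_ge0 (psi x (`|a|^-1 *: a))).
move=> h; rewrite lecR; apply: (@ler_half_iter _ _ C) => n.
have := h n; rewrite normrZ normfV normr_id mulVf ?gt_eqF// => /(_ (lexx _)).
by rewrite -lecR; congr (_ <= _); rewrite rmorphD rmorphM fmorphV rmorphXn rmorph_nat.
Qed.

End PositiveFunctional.

(** * Hahn-Banach separation *)

Section SublinearDomination.
Variables (R : realType) (V : lmodType R).

Definition sublinear (p : V -> R) :=
  (forall x y, p (x + y) <= p x + p y) /\
  (forall t x, 0 <= t -> p (t *: x) <= t * p x).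

Lemma sublinear0 p : sublinear p -> p 0 = 0.
Proof.
move=> [pD pZ]; apply/eqP; rewrite eq_le; apply/andP; split.
  by have := pZ 0 0 (lexx _); rewrite scale0r mul0r.
by have := pD 0 0; rewrite addr0; lra.
Qed.

Lemma sublinear_ge p x : sublinear p -> - p (- x) <= p x.
Proof. by move=> sp; have := sp.1 x (- x); rewrite subrr (sublinear0 sp); lra. Qed.

Lemma sublinearZ p t x : sublinear p -> 0 <= t -> p (t *: x) = t * p x.
Proof.
move=> sp; rewrite le_eqVlt => /predU1P[<-|t0].
  by rewrite scale0r mul0r sublinear0.
apply/eqP; rewrite eq_le (sp.2 _ _ (ltW t0))/= mulrC -ler_pdivlMr// mulrC.
rewrite -{1}[x]scale1r -(@mulVf _ t) ?gt_eqF// -scalerA sp.2// invr_ge0 ltW//.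
Qed.

Lemma inf_le (A : set R) (b x : R) : (forall y, A y -> b <= y) -> A x -> inf A <= x.
Proof. by move=> Ab Ax; apply: ge_inf => //; exists b => y /Ab. Qed.

Lemma le_inf (A : set R) (b x : R) : A x -> (forall y, A y -> b <= y) -> b <= inf A.
Proof. by move=> Ax Ab; apply: lb_le_inf; [exists x|move=> y /Ab]. Qed.

(** Zorn's lemma for the reversed pointwise order [le]. A chain is bounded by its pointwise infimum,
    which is finite because every member is at least [- p (- x)] at [x]. *)
Lemma sublinear_minimal (p : V -> R) : sublinear p ->
  exists q, [/\ sublinear q, forall x, q x <= p x &
    forall q', sublinear q' -> (forall x, q' x <= q x) -> q' = q].
Proof.
move=> sp; pose T := {q : V -> R | sublinear q /\ forall x, q x <= p x}.
pose le (q q' : T) : bool := `[< forall x, sval q' x <= sval q x >].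
have := @Zorn T le; case.
- by move=> q; apply/asboolP.
- move=> r s t /asboolP rs /asboolP st; apply/asboolP => x.
  exact: le_trans (st x) (rs x).
- move=> [s ps] [t pt] /asboolP /= st /asboolP /= ts.
  by apply: eq_exist; apply/funext => x; apply/eqP; rewrite eq_le st ts.
- move=> A Atot; have [[q0 Aq0]|A0] := pselect (exists q, A q); last first.
    exists (exist _ p (conj sp (fun x => lexx (p x)))) => s As.
    by case: A0; exists s.
  pose v x := [set sval q x | q in A].
  have vlb x y : v x y -> - p (- x) <= y.
    move=> [[q [sq qp]] _ /= <-]; apply: le_trans (sublinear_ge _ sq).
    by rewrite lerN2.
  have vq x : v x (sval q0 x) by exists q0.
  have sinf : sublinear (fun x => inf (v x)).
    split=> [x y|t x t0].
      rewrite -lerBlDr; apply: (le_inf (vq x)) => _ [q1 Aq1 <-].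
      rewrite lerBlDr -lerBlDl; apply: (le_inf (vq y)) => _ [q2 Aq2 <-].
      rewrite lerBlDl.
      (* Subadditivity of the infimum needs one functional below both [q1] and [q2]; totality of the
         chain supplies it. *)
      have [q [Aq h1 h2]] : exists q : T, [/\ A q, sval q x <= sval q1 x & sval q y <= sval q2 y].
        have [/asboolP h|/asboolP h] := Atot _ _ Aq1 Aq2.
          by exists q2; split => //; exact: h.
        by exists q1; split => //; exact: h.
      apply: le_trans (lerD h1 h2); apply: le_trans ((svalP q).1.1 x y).
      by apply: (inf_le (vlb _)); exists q.
    move: t0; rewrite le_eqVlt => /predU1P[<-|t0].
      rewrite scale0r mul0r -(sublinear0 (svalP q0).1).
      exact: (inf_le (vlb _)).
    rewrite mulrC -ler_pdivrMr//; apply: (le_inf (vq x)) => _ [q Aq <-].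
    rewrite ler_pdivrMr// mulrC; apply: le_trans ((svalP q).1.2 _ _ (ltW t0)).
    by apply: (inf_le (vlb _)); exists q.
  have pinf x : inf (v x) <= p x.
    exact: le_trans (inf_le (vlb x) (vq x)) ((svalP q0).2 x).
  pose Q : T := exist _ (fun x => inf (v x)) (conj sinf pinf).
  exists Q => s As; apply/asboolP => x /=.
  by apply: (inf_le (vlb x)); exists s.
move=> [q [sq qp]] qmin; exists q; split=> // q' sq' q'q.
have q'p x : q' x <= p x by exact: le_trans (qp x).
have := qmin (exist _ q' (conj sq' q'p)).
by rewrite /le /= asboolT// => /(_ isT) [].
Qed.

(* A minimal sublinear functional [q] is linear: for fixed [w], the sublinear
   functional [x |-> inf_(t >= 0) (q (x + t w) - t q w)] lies below [q]. *)
Theorem sublinear_dominates (p : V -> R) : sublinear p ->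
  exists L : V -> R, [/\ forall x y, L (x + y) = L x + L y,
    forall t x, L (t *: x) = t * L x & forall x, L x <= p x].
Proof.
move=> /sublinear_minimal [q [sq qp qmin]]; exists q.
have qD x w : q (x + w) = q x + q w.
  apply/eqP; rewrite eq_le sq.1/= -lerBrDr.
  pose v x := [set q (x + t *: w) - t * q w | t in [set t | 0 <= t]].
  have vlb y z : v y z -> - q (- y) <= z.
    move=> [t t0 <-]; rewrite -(sublinearZ _ sq)//.
    by have := sq.1 (y + t *: w) (- y); rewrite addrC addKr; lra.
  have vt y t : 0 <= t -> v y (q (y + t *: w) - t * q w) by exists t.
  rewrite -[leLHS](_ : inf (v x) = q x).
    by apply: (inf_le (vlb x)); exists 1 => //=; rewrite scale1r mul1r.
  apply: (congr1 (fun q' : V -> R => q' x) (_ : (fun y => inf (v y)) = q)).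
  apply: qmin; last first.
    move=> y; apply: (inf_le (vlb y)); exists 0 => //=.
    by rewrite scale0r addr0 mul0r subr0.
  have vq y := vt y 0 (lexx _).
  split=> [y z|s y s0].
    rewrite -lerBlDr; apply: (le_inf (vq y)) => _ [t t0 <-].
    rewrite lerBlDr -lerBlDl; apply: (le_inf (vq z)) => _ [r r0 <-].
    rewrite lerBlDl; apply: le_trans (inf_le (vlb _) (vt _ _ (addr_ge0 t0 r0))) _.
    rewrite scalerDl addrACA.
    have := sq.1 (y + t *: w) (z + r *: w); set a := q (_ + _); lra.
  move: s0; rewrite le_eqVlt => /predU1P[<-|s0].
    rewrite scale0r mul0r; apply: le_trans (inf_le (vlb _) (vq _)) _.
    by rewrite scale0r addr0 mul0r subr0 (sublinear0 sq).
  rewrite mulrC -ler_pdivrMr//; apply: (le_inf (vq y)) => _ [t t0 <-].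
  rewrite ler_pdivrMr//; apply: le_trans (inf_le (vlb _) (vt _ _ (mulr_ge0 (ltW s0) t0))) _.
  rewrite -scalerA -scalerDr (sublinearZ _ sq) ?(ltW s0)//.
  by rewrite le_eqVlt; apply/orP; left; apply/eqP; ring.
split=> // t x; have [t0|t0] := leP 0 t; first exact: sublinearZ.
have qN y : q (- y) = - q y.
  by apply/eqP; rewrite -addr_eq0 -qD addNr (sublinear0 sq).
rewrite -[t]opprK scaleNr qN (sublinearZ _ sq) ?mulNr//.
by rewrite oppr_ge0 ltW.
Qed.

(** The infimum of [A v] over nonnegative combinations is a sublinear function of [v], finite by the
    third hypothesis. A linear [L] below it is below [N] (empty combination), and evaluating it at
    [- c j] with the combination [c j] gives [d <= L (c j)]. *)
Lemma cone_separation (N : V -> R) (J : Type) (c : J -> V) (d : R) :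
    (forall x y, N (x + y) <= N x + N y) ->
    (forall t x, N (t *: x) = `|t| * N x) ->
    (forall l : seq (R * J), all (fun k => 0 <= k.1) l ->
      d * (\sum_(k <- l) k.1) <= N (\sum_(k <- l) k.1 *: c k.2)) ->
  exists L : V -> R, [/\ forall x y, L (x + y) = L x + L y,
    forall x, L x <= N x & forall j, d <= L (c j)].
Proof.
move=> ND NZ dN.
pose A v := [set N (v + \sum_(k <- l) k.1 *: c k.2) - d * (\sum_(k <- l) k.1)
  | l in [set l : seq (R * J) | all (fun k => 0 <= k.1) l]].
have NN x : N (- x) = N x by rewrite -scaleN1r NZ normrN1 mul1r.
have Alb v y : A v y -> - N v <= y.
  move=> [l l0 <-]; have := dN l l0.
  by have := ND (v + \sum_(k <- l) k.1 *: c k.2) (- v); rewrite addrC addKr NN; lra.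
have Al v l : all (fun k => 0 <= k.1) l ->
   A v (N (v + \sum_(k <- l) k.1 *: c k.2) - d * (\sum_(k <- l) k.1)) by exists l.
have A0 v : A v (N v) by exists [::]; rewrite //= !big_nil addr0 mulr0 subr0.
have [|L [LD LZ Lle]] := @sublinear_dominates (fun v => inf (A v)).
  split=> [x y|t x].
    rewrite -lerBlDr; apply: (le_inf (A0 x)) => _ [l l0 <-].
    rewrite lerBlDr -lerBlDl; apply: (le_inf (A0 y)) => _ [r r0 <-].
    rewrite lerBlDl; have lr0 : all (fun k => 0 <= k.1) (l ++ r) by rewrite all_cat l0.
    apply: le_trans (inf_le (Alb _) (Al _ _ lr0)) _.
    rewrite !big_cat/= addrACA.
    set a := \sum_(k <- l) _ *: _; set b := \sum_(k <- r) _ *: _.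
    have := ND (x + a) (y + b); lra.
  rewrite le_eqVlt => /predU1P[<-|t0].
    rewrite scale0r mul0r; apply: le_trans (inf_le (Alb _) (A0 _)) _.
    by rewrite -(scale0r 0) NZ normr0 mul0r.
  rewrite mulrC -ler_pdivrMr//; apply: (le_inf (A0 x)) => _ [l l0 <-].
  pose r := [seq (t * k.1, k.2) | k <- l].
  have r0 : all (fun k => 0 <= k.1) r.
    by rewrite all_map; apply: sub_all l0 => k /= k0; rewrite mulr_ge0// ltW.
  rewrite ler_pdivrMr//; apply: le_trans (inf_le (Alb _) (Al _ _ r0)) _.
  rewrite !big_map/= -mulr_sumr; under eq_bigr do rewrite -scalerA.
  rewrite -scaler_sumr -scalerDr NZ gtr0_norm//.
  by rewrite le_eqVlt; apply/orP; left; apply/eqP; ring.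
exists L; split=> // [x|j]; first exact: le_trans (Lle x) (inf_le (Alb x) (A0 x)).
have L0 : L 0 = 0 by rewrite -(scale0r 0) LZ mul0r.
have : L (- c j) = - L (c j) by rewrite -scaleN1r LZ mulN1r.
have h : all (fun k : R * J => 0 <= k.1) [:: (1, j)] by rewrite /= ler01.
have := le_trans (Lle (- c j)) (inf_le (Alb _) (Al _ _ h)).
rewrite !big_seq1/= scale1r addNr -(scale0r 0) NZ normr0 mul0r; lra.
Qed.

End SublinearDomination.

(** * Almost invariant vectors *)

Section FinitelySupportedFunctions.
Variables (I : choiceType) (R : realType).

(** Cut out by a predicate so that the subspace structure can be derived: the separation lemma is
    applied to the resulting real vector space with its l^1 norm. *)
Definition finsupp_pred : {pred I -> R} :=
  fun f => `[< finite_set [set x | f x != 0] >].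

Lemma finsupp_pred_submod : submod_closed finsupp_pred.
Proof.
split.
  apply/asboolP; rewrite (_ : [set x | _] = set0) //.
  by apply/seteqP; split => // x /=; rewrite eqxx.
move=> a f g /asboolP F /asboolP H; apply/asboolP.
apply: (@sub_finite_set _ _ ([set x | f x != 0] `|` [set x | g x != 0])); last by rewrite finite_setU.
move=> x /=; apply: contraNP => /not_orP [/negP/negbNE/eqP fx /negP/negbNE/eqP gx].
by rewrite /= !fctE fx gx /= scaler0 addr0.
Qed.

HB.instance Definition _ :=
  GRing.isSubmodClosed.Build R (I -> R) finsupp_pred finsupp_pred_submod.
Record finsupp := Finsupp { finsupp_val :> I -> R; _ : finsupp_val \in finsupp_pred }.
HB.instance Definition _ := [isSub for finsupp_val].
HB.instance Definition _ := [Choice of finsupp by <:].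
HB.instance Definition _ := [SubChoice_isSubLmodule of finsupp by <:].

Lemma finsuppP (f : finsupp) : finite_set [set x | f x != 0].
Proof. by case: f => f /= /asboolP. Qed.

Lemma finsuppD (f g : finsupp) x : (f + g) x = f x + g x.
Proof. by []. Qed.

Lemma finsuppZ (a : R) (f : finsupp) x : (a *: f) x = a * f x.
Proof. by []. Qed.

Lemma finsuppN (f : finsupp) x : (- f) x = - f x.
Proof. by []. Qed.

Lemma finsupp_sum (J : Type) (r : seq J) (F : J -> finsupp) x :
  (\sum_(j <- r) F j) x = \sum_(j <- r) F j x.
Proof. by elim: r => [|j r IH]; rewrite ?big_nil// !big_cons finsuppD IH. Qed.

Lemma finsupp_delta_subproof (k : I) : (fun x => (x == k)%:R) \in finsupp_pred.
Proof.
apply/asboolP; apply: sub_finite_set (finite_set1 k) => x /=.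
by case: (x =P k) => // _; rewrite eqxx.
Qed.

Definition finsupp_delta k := Finsupp (finsupp_delta_subproof k).

Definition norm1 (f : finsupp) : R := \sum_(x \in [set: I]) `|f x|.

Lemma norm1E (A : set I) (f : finsupp) : finite_set A ->
  (forall x, f x != 0 -> A x) -> norm1 f = \sum_(x \in A) `|f x|.
Proof.
move=> fA Af; apply/esym/fsbig_widen => // x [_ /= nAx].
by apply/eqP; rewrite normr_eq0; apply: contra_notT nAx => /Af.
Qed.

Lemma norm1D f g : norm1 (f + g) <= norm1 f + norm1 g.
Proof.
pose A := [set x | f x != 0] `|` [set x | g x != 0].
have fA : finite_set A by rewrite finite_setU; split; exact: finsuppP.
rewrite !(@norm1E A) //; first last.
- move=> x; apply: contra_neqP => /not_orP [/negP/negbNE/eqP fx /negP/negbNE/eqP gx].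
  by rewrite finsuppD fx gx addr0.
- by move=> x; left.
- by move=> x; right.
by rewrite -fsbig_split// !fsbig_finite//; apply: ler_sum => x _; exact: ler_normD.
Qed.

Lemma norm1Z (a : R) f : norm1 (a *: f) = `|a| * norm1 f.
Proof.
rewrite /norm1 mulr_fsumr; apply: eq_fsbigr => x _.
by rewrite finsuppZ normrM.
Qed.

Lemma norm1_ge (w : seq I) (f : finsupp) : uniq w ->
  \sum_(x <- w) `|f x| <= norm1 f.
Proof.
move=> uw; pose A := [set` w] `|` [set x | f x != 0].
have fA : finite_set A by rewrite finite_setU; split => //; exact: finsuppP.
rewrite (@norm1E A)//; last by move=> x; right.
rewrite fsbig_seq// (fsbigID [set` w] A)//= setUK lerDl.
by apply: fsumr_ge0.
Qed.

Lemma norm1_delta k : norm1 (finsupp_delta k) = 1.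
Proof.
rewrite (@norm1E [set k]) ?fsbig_set1 /= ?eqxx ?normr1//.
by move=> x /=; case: (x =P k) => // _; rewrite eqxx.
Qed.

End FinitelySupportedFunctions.

Lemma bounded_inP (R : realType) (T : Type) (S : set T) (f : T -> R) (M : R) :
  (forall x, S x -> `|f x| <= M) -> [bounded f x | x in S].
Proof.
move=> fM; exists M; split; first exact: num_real.
by move=> N MN x Sx; exact: le_trans (fM x Sx) (ltW MN).
Qed.

(** * From an invariant mean to almost invariant vectors *)

Section AlmostInvariantVectors.
Variables (R : realType) (T : choiceType) (S : set T) (mul : T -> T -> T).
Hypothesis mulI : forall g x y, S g -> S x -> S y -> mul g x = mul g y -> x = y.
Variable m : (T -> R) -> R.
Hypothesis m_lin : forall (a : R) (f g : T -> R),
  [bounded f x | x in S] -> [bounded g x | x in S] ->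
  m (fun x => a * f x + g x) = a * m f + m g.
Hypothesis m_ge0 : forall f : T -> R, [bounded f x | x in S] ->
  (forall x, S x -> 0 <= f x) -> 0 <= m f.
Hypothesis m1 : m (fun=> 1) = 1.
Hypothesis m_inv : forall (h : T) (f : T -> R), S h -> [bounded f x | x in S] ->
  m (fun x => f (mul h x)) = m f.

(** Invariance kills each summand. Boundedness is carried through the induction because [m] is
    linear on bounded functions only. *)
Lemma mean_coboundary (F : seq T) (f : T -> T -> R) : {in F, forall g, S g} ->
  (forall g x, `|f g x| <= 1) ->
  m (fun x => \sum_(g <- F) (f g (mul g x) - f g x)) = 0.
Proof.
move=> + f1; have B (G : seq T) (h : T -> T -> R) M : (forall g x, `|h g x| <= M) ->
    [bounded \sum_(g <- G) h g x | x in S].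
  move=> hM; apply: (@bounded_inP _ _ _ _ (\sum_(g <- G) M)) => x _.
  by apply: le_trans (ler_norm_sum _ _ _) _; apply: ler_sum.
have fB g x : `|f g (mul g x) - f g x| <= 2.
  by apply: le_trans (ler_normB _ _) _; apply: le_trans (lerD (f1 _ _) (f1 _ _)) _.
have m0 : m (fun=> 0) = 0.
  have /m_lin := bounded_inP (fun x (_ : S x) => lexx `|0 : R|).
  move=> /(_ (-1) _ (bounded_inP (fun x (_ : S x) => lexx `|0 : R|))).
  by under eq_fun do rewrite mulr0 addr0; lra.
elim: F => [|g F IH] FS.
  by under eq_fun do rewrite big_nil.
have Sg : S g by apply: FS; rewrite inE eqxx.
have {}IH : m (fun x => \sum_(g0 <- F) (f g0 (mul g0 x) - f g0 x)) = 0.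
  by apply: IH => h hF; apply: FS; rewrite inE hF orbT.
under eq_fun do rewrite big_cons -[f g _ - _]mul1r.
have bfg : [bounded f g x | x in S].
  by apply: (@bounded_inP _ _ _ _ 1).
have bfg' : [bounded f g (mul g x) | x in S].
  by apply: (@bounded_inP _ _ _ _ 1).
rewrite m_lin; first last.
- exact: B fB.
- by apply: (@bounded_inP _ _ _ _ 2).
rewrite IH addr0 mul1r.
under eq_fun do rewrite addrC -[- _]mulN1r.
by rewrite m_lin// m_inv// mulN1r addNr.
Qed.

(* Reiter's condition.  If it failed, Hahn-Banach would give bounded functions
   [f_g] with [\sum_g (f_g (g s) - f_g s) >= d] for all [s], which the
   invariant mean would send to [0]. *)
Lemma reiter (F : seq T) (d : R) : uniq F -> {in F, forall g, S g} -> 0 < d ->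
  exists l : seq (R * T), [/\ all (fun k => 0 <= k.1) l,
    forall k, k \in l -> S k.2, \sum_(k <- l) k.1 = 1 &
    forall g, g \in F -> forall w, uniq w -> {in w, forall x, S x} ->
    \sum_(x <- w) `|(\sum_(k <- l) k.1 * (x == k.2)%:R)
           - \sum_(k <- l) k.1 * (mul g x == k.2)%:R| <= d].
Proof.
move=> uF FS d0.
pose J := {x | S x}.
(* The vectors to separate from 0 live in an l^1 sum of copies of l^1 indexed by [F]: the component
   of [c j] at [g] is the translate by [g] of the point mass at [j], minus that point mass. *)
pose c (j : J) := \sum_(g <- F)
  (finsupp_delta R (g, mul g (sval j)) - finsupp_delta R (g, sval j)).
have [H|] := pselect (forall l : seq (R * J), all (fun k => 0 <= k.1) l ->
   d * (\sum_(k <- l) k.1) <= norm1 (\sum_(k <- l) k.1 *: c k.2)).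
  have [L [LD LN dL]] := cone_separation (@norm1D _ _) (@norm1Z _ _) H.
  have L0 : L 0 = 0 by have := LD 0 0; rewrite addr0; lra.
  have LB x y : L (x - y) = L x - L y.
    apply/eqP; rewrite -subr_eq opprK -LD subrK//.
  have Lsum (r : seq T) (G : T -> finsupp _ R) : L (\sum_(g <- r) G g) = \sum_(g <- r) L (G g).
    by elim: r => [|g r IH]; rewrite ?big_nil// !big_cons LD IH.
  pose f g x := L (finsupp_delta R (g, x)).
  have f1 g x : `|f g x| <= 1.
    rewrite ler_norml -(norm1_delta R (g, x)) LN andbT lerNl.
    have -> : - f g x = L (- finsupp_delta R (g, x)) by rewrite -[- finsupp_delta _ _]add0r LB L0 add0r.
    apply: le_trans (LN _) _.
    by rewrite -scaleN1r norm1Z normrN1 mul1r.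
  have := mean_coboundary FS f1.
  have dle x : S x -> d <= \sum_(g <- F) (f g (mul g x) - f g x).
    move=> Sx; have := dL (exist _ x Sx); rewrite /c Lsum /=.
    by under eq_bigr do rewrite LB.
  have bd : [bounded \sum_(g <- F) (f g (mul g x) - f g x) | x in S].
    apply: (@bounded_inP _ _ _ _ (\sum_(g <- F) 2)) => x _.
    apply: le_trans (ler_norm_sum _ _ _) _; apply: ler_sum => g _.
    by apply: le_trans (ler_normB _ _) _; apply: le_trans (lerD (f1 _ _) (f1 _ _)) _.
  have b1 : [bounded (1 : R) | x in S].
    by apply: (@bounded_inP _ _ _ _ 1) => x _; rewrite normr1.
  (* This function is nonnegative on [S], yet its mean is [- d]. *)
  have := @m_ge0 (fun x => - d * 1 + \sum_(g <- F) (f g (mul g x) - f g x)).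
  rewrite m_lin// m1 => h h2; move: h; rewrite h2 => /(_ _ _)/= h.
  have : 0 <= - d * 1 + 0.
    apply: h => [|x Sx]; last by have := dle x Sx; lra.
    apply: (@bounded_inP _ _ _ _ (d + \sum_(g <- F) 2)) => x _.
    apply: le_trans (ler_normD _ _) _; rewrite mulr1 normrN gtr0_norm// lerD2l.
    apply: le_trans (ler_norm_sum _ _ _) _; apply: ler_sum => g _.
    by apply: le_trans (ler_normB _ _) _; apply: le_trans (lerD (f1 _ _) (f1 _ _)) _.
  lra.
(* A combination violating the bound has positive total weight [t]; dividing by [t] yields the
   probability vector. *)
move=> /existsNP [l /not_implyP [l0 /negP]]; rewrite -ltNge => ld.
set t := \sum_(k <- l) k.1 in ld.
have t0 : 0 < t.
  have : 0 < d * t; last by rewrite pmulr_rgt0.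
  by apply: le_lt_trans ld; apply: fsumr_ge0.
exists [seq (k.1 / t, sval k.2) | k <- l]; split.
- by rewrite all_map; apply: sub_all l0 => k /= k0; rewrite divr_ge0// ltW.
- have /allP lS : all (fun k => `[< S k.2 >]) [seq (k.1 / t, sval k.2) | k <- l].
    rewrite all_map (eq_all (a2 := predT)) ?all_predT// => k.
    by apply/asboolP; exact: svalP.
  by move=> k /lS /asboolP.
- by rewrite big_map/= -mulr_suml divff// gt_eqF.
move=> g gF w uw wS; rewrite -(ler_pM2l t0) [t * d]mulrC.
apply: le_trans (ltW ld).
(* The coordinate of the combination at [(g, mul g x)] is, up to the factor [t], the difference of
   the vector at [x] and at [mul g x]. These coordinates are distinct for distinct [x] by [mulI], so
   [norm1] bounds their sum. *)
have uw' : uniq [seq (g, mul g x) | x <- w].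
  rewrite map_inj_in_uniq// => x y xw yw [] /mulI; apply; auto.
apply: le_trans (norm1_ge _ uw'); rewrite big_map mulr_sumr.
rewrite le_eqVlt; apply/orP; left; apply/eqP.
rewrite big_seq [RHS]big_seq; apply: eq_bigr => x xw.
rewrite -[t in t * _](gtr0_norm t0) -normrM; congr (`| _ |).
rewrite finsupp_sum !big_map mulrBr !mulr_sumr -sumrB; apply: eq_bigr => k _.
rewrite finsuppZ /c finsupp_sum (bigD1_seq g)// big1 ?addr0; last first.
  move=> h /negPf hg.
rewrite finsuppD finsuppN /= !xpair_eqE.
  by rewrite eq_sym hg /= subrr.
rewrite finsuppD finsuppN /= !xpair_eqE eqxx /=.
have -> : (mul g x == mul g (sval k.2)) = (x == sval k.2).
  apply/eqP/eqP => [/mulI|->//]; apply; [auto|auto|exact: svalP].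
by field; rewrite gt_eqF.
Qed.

(** The vector is the square root of the probability vector [p] of [reiter]: the square of a
    difference of square roots is at most the difference of the radicands in absolute value. *)
Lemma almost_invariant_vector (F : seq T) (d : R) :
    uniq F -> {in F, forall g, S g} -> 0 < d ->
  exists (w : seq T) (xi : T -> R),
    [/\ uniq w, {in w, forall x, S x}, forall x, x \notin w -> xi x = 0,
      \sum_(x <- w) xi x ^+ 2 = 1 &
      forall g, g \in F -> `|1 - \sum_(x <- w) xi (mul g x) * xi x| <= d].
Proof.
move=> uF FS d0; have [l [l0 lS l1 ld]] := reiter uF FS d0.
pose p x := \sum_(k <- l) k.1 * (x == k.2)%:R.
have p0 x : 0 <= p x.
  rewrite /p big_seq; apply: sumr_ge0 => k kl; rewrite mulr_ge0 ?ler0n//.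
  by move/allP : l0; apply.
pose w := undup [seq k.2 | k <- l].
have uw : uniq w by exact: undup_uniq.
have wS : {in w, forall x, S x}.
  by move=> x; rewrite mem_undup => /mapP [k kl ->]; exact: lS.
have sq x : Num.sqrt (p x) ^+ 2 = p x by rewrite sqr_sqrtr.
have sp : \sum_(x <- w) p x = 1.
  rewrite -l1 /p exchange_big/= big_seq [RHS]big_seq; apply: eq_bigr => k kl.
  rewrite -mulr_sumr (bigD1_seq k.2)//=; last by rewrite mem_undup; apply/mapP; exists k.
  by rewrite eqxx big1 ?addr0 ?mulr1// => x /negPf ->.
exists w, (fun x => Num.sqrt (p x)); split => //.
- move=> x; rewrite mem_undup => xw; rewrite /p big_seq big1 ?sqrtr0// => k kl.
  by case: eqP => [xk|]; rewrite ?mulr0//; case/mapP: xw; exists k.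
- by under eq_bigr do rewrite sq.
move=> g gF; have := ld g gF w uw wS; rewrite -/p => h.
(* The correction [p x - p (mul g x)] appears because [w] need not be stable under [g], so the
   translated weights may sum to less than 1 over [w]. *)
have -> : 1 - \sum_(x <- w) Num.sqrt (p (mul g x)) * Num.sqrt (p x) =
    2^-1 * \sum_(x <- w) ((Num.sqrt (p x) - Num.sqrt (p (mul g x))) ^+ 2 + (p x - p (mul g x))).
  under [in RHS]eq_bigr do rewrite sqrrB !sq.
  rewrite -[in LHS]sp -sumrB mulr_sumr; apply: eq_bigr => x _.
  set a := Num.sqrt _; set b := Num.sqrt _; move: (p x) (p _) => u v.
  by field.
rewrite normrM gtr0_norm ?invr_gt0// ler_pdivrMl//.
apply: le_trans (ler_norm_sum _ _ _) _; rewrite mulr_natl mulr2n.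
apply: le_trans (lerD h h); rewrite -big_split; apply: ler_sum => x _ /=.
apply: le_trans (ler_normD _ _) _; rewrite lerD2r.
have -> : p x - p (mul g x) = (Num.sqrt (p x) - Num.sqrt (p (mul g x))) *
    (Num.sqrt (p x) + Num.sqrt (p (mul g x))) by rewrite -subr_sqr !sq.
have sx := sqrtr_ge0 (p x); have sy := sqrtr_ge0 (p (mul g x)).
rewrite expr2 !normrM; apply: ler_wpM2l => //.
by rewrite ler_norml ger0_norm ?addr_ge0//; apply/andP; split; lra.
Qed.

End AlmostInvariantVectors.

(** * Étale groupoids *)

Section GroupoidAlgebra.
Variable G : groupoid.
Implicit Types x y b : G.

Lemma gmulK x b : gsrc x = grng b -> gmul (gmul x b) (ginv b) = x.
Proof. by move=> h; rewrite -gmulA ?grng_inv// gmul_inv -h gmul_unit. Qed.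

Lemma gmulVK x b : gsrc x = gsrc b -> gmul (gmul x (ginv b)) b = x.
Proof. by move=> h; rewrite -gmulA ?grng_inv ?gsrc_inv// ginv_mul -h gmul_unit. Qed.

Lemma gmulKl x b : gsrc b = grng x -> gmul (ginv b) (gmul b x) = x.
Proof. by move=> h; rewrite gmulA ?gsrc_inv// ginv_mul h gunit_mul. Qed.

Lemma gmulVKl x b : grng b = grng x -> gmul b (gmul (ginv b) x) = x.
Proof. by move=> h; rewrite gmulA ?gsrc_inv ?grng_inv// gmul_inv h gunit_mul. Qed.

Lemma gmul_eq_unit x y : gsrc x = grng y -> gmul x y = gunit (gsrc y) -> x = ginv y.
Proof.
by move=> h e; rewrite -(gmulK h) e -{1}grng_inv gunit_mul.
Qed.

Lemma ginvK x : ginv (ginv x) = x.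
Proof. by apply/esym/gmul_eq_unit; rewrite ?grng_inv// gmul_inv gsrc_inv. Qed.

Lemma ginv_unit u : ginv (gunit u : G) = gunit u.
Proof.
apply/esym/gmul_eq_unit; rewrite ?gsrc_unit ?grng_unit//.
by rewrite -{2}(gsrc_unit (g := G) u) gmul_unit.
Qed.

Lemma ginvM x y : gsrc x = grng y -> ginv (gmul x y) = gmul (ginv y) (ginv x).
Proof.
move=> h; apply/esym/gmul_eq_unit.
  by rewrite gsrc_mul ?gsrc_inv ?grng_inv// grng_mul.
rewrite -gmulA ?gsrc_inv ?grng_inv ?grng_mul ?gsrc_mul ?gsrc_inv ?grng_inv//.
by rewrite gmulKl// ginv_mul.
Qed.

Definition fiber (u : gobj G) : set G := [set x | gsrc x = u].

Variable R : realType.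
Implicit Types f g h : G -> cplx R.

(** A factorisation of [x] is determined by its right factor [b], the left one being
    [gmul x (ginv b)]; so a convolution is a sum over one source fibre. *)
Lemma convE f g x :
  conv f g x = \sum_(b \in fiber (gsrc x)) f (gmul x (ginv b)) * g b.
Proof.
apply: (reindex_fsbig (fun b => (gmul x (ginv b), b))); split.
- move=> b /= sb; rewrite gsrc_mul ?grng_inv// gsrc_inv; split=> //.
  by rewrite gmulVK.
- by move=> a b _ _ [].
- move=> [a b] /= [ab <-]; exists b => /=; first by rewrite /fiber/= gsrc_mul.
  by rewrite gmulK.
Qed.

(** The left factor [gmul x (ginv b)] can be a unit only for [b = x]. *)
Lemma conv_unit_rangel f g x : (forall y, ~ range (@gunit G) y -> f y = 0) ->
  conv f g x = f (gunit (grng x)) * g x.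
Proof.
move=> f0; rewrite convE -(fsbig_widen [set x])/=; first last.
- move=> b [sb bx] /=; rewrite f0 ?mul0r//.
  move=> [u _ e]; apply: bx; have := gmulVK (esym sb); rewrite -e => <-.
  have -> : u = grng b; last by rewrite gunit_mul.
  by have := gsrc_inv b; rewrite -(@gsrc_mul _ x) ?grng_inv// -e gsrc_unit.
- by move=> b ->.
by rewrite fsbig_set1 gmul_inv.
Qed.

(** A nonzero term would put both [b] and [b x^-1] in [V]. They have the same range, hence coincide,
    and [x] is a unit. *)
Lemma conv_invol_inj f x (V : set G) : set_inj V (@grng G) ->
  (forall y, ~ V y -> f y = 0) -> ~ range (@gunit G) x -> conv (invol f) f x = 0.
Proof.
move=> Vinj f0 xu; rewrite convE fsbig1// => b sb.
have [Vb|/f0 ->] := pselect (V b); last by rewrite mulr0.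
have [Vxb|/f0] := pselect (V (ginv (gmul x (ginv b)))); last first.
  by rewrite /invol => ->; rewrite conjC0 mul0r.
exfalso; apply: xu; exists (gsrc b) => //; rewrite -ginv_mul.
rewrite -[X in gmul X _](_ : gmul x (ginv b) = _) ?gmulVK//.
rewrite -[LHS]ginvK; congr ginv; apply: Vinj; rewrite ?inE//.
by rewrite grng_inv gsrc_mul ?grng_inv// gsrc_inv.
Qed.

(** The right-hand side is the inner product of the restrictions to the fibre, as in the regular
    representation on l^2 of [s^-1(u)]. *)
Lemma conv_invol_unit f g u :
  conv (invol f) g (gunit u) = \sum_(b \in fiber u) (f b)^* * g b.
Proof.
rewrite convE gsrc_unit; apply: eq_fsbigr => b /set_mem sb.
by rewrite /invol -[u]sb -grng_inv gunit_mul ginvK.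
Qed.

End GroupoidAlgebra.

(** If [D] were infinite, the filter of sets containing all but finitely many points of [D] would
    cluster at some point of [K], against the neighbourhood [V] of that point. *)
Lemma compact_finite_discrete (X : topologicalType) (K D : set X) :
  compact K -> D `<=` K ->
  (forall x, K x -> exists2 V, nbhs x V & finite_set (D `&` V)) ->
  finite_set D.
Proof.
move=> cK DK loc; apply: contrapT => infD.
pose F := [set A | finite_set (D `\` A)].
have FF : ProperFilter F.
  apply: Build_ProperFilter_ex.
    move=> A FA; apply: contrapT => A0; apply: infD.
    apply: sub_finite_set FA => x Dx; split => // Ax.
    by apply: A0; exists x.
  split.
  - by rewrite /F /= setDT.
  - move=> A B FA FB; rewrite /F /= setDIr finite_setU; split => //.
  - by move=> A B AB; apply: sub_finite_set => x [Dx nBx]; split => // /AB.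
have [|x [Kx /= clx]] := cK F FF.
  by rewrite /F /= (_ : _ `\` _ = set0)//; apply/seteqP; split => // x [/DK].
have [V Vx fV] := loc x Kx.
have FV : F (~` V) by rewrite /F /= setDE setCK.
by have [y []] := clx _ _ FV Vx.
Qed.

(** * Bisections, local sections and the interior of the isotropy *)

Section GroupoidTopology.
Variable G : groupoid.
Hypothesis G_hausdorff : hausdorff_space G.
Hypothesis G_etale : etale G.

Lemma gobj_hausdorff : hausdorff_space (gobj G).
Proof.
move=> u v uv; rewrite -(gsrc_unit (g := G) u) -(gsrc_unit (g := G) v).
congr gsrc; apply: G_hausdorff => A B /gunit_continuous Au /gunit_continuous Bv.
by have [w [Aw Bw]] := uv _ _ Au Bv; exists (gunit w).
Qed.

Lemma local_homeomorphism_open (X Y : topologicalType) (f : X -> Y) (A : set X) :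
  local_homeomorphism f -> open A -> open (f @` A).
Proof.
move=> lf oA; rewrite openE => _ [x Ax <-].
have [U [g [oU Ux ofU _ [gc gK]]]] := lf x.
rewrite /interior; apply: (@filterS _ _ _ (f @` U `&` g @^-1` (A `&` U))).
  by move=> _ [[z Uz <-] /= [Agz _]]; rewrite gK// in Agz; exists z.
apply: filterI; first by apply: open_nbhs_nbhs; split => //; exists x.
move: gc; rewrite continuous_open_subspace// => /(_ (f x)).
rewrite inE => /(_ (ex_intro2 _ _ x Ux erefl)); apply; rewrite gK//.
by apply: open_nbhs_nbhs; split => //; exact: openI.
Qed.

Definition bisection (V : set G) :=
  [/\ open V, set_inj V (@gsrc G) & set_inj V (@grng G)].

Lemma bisection_basis (x : G) (W : set G) : nbhs x W ->
  exists V, [/\ bisection V, V x & V `<=` W].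
Proof.
move=> Wx; have [U1 [h1 [oU1 U1x _ _ [_ K1]]]] := G_etale.1 x.
have [U2 [h2 [oU2 U2x _ _ [_ K2]]]] := G_etale.2 x.
exists (U1 `&` U2 `&` W°); split; last by move=> y [_ /interior_subset].
- split; first by apply: openI; [exact: openI|exact: open_interior].
  + move=> a b /set_mem[[_ Ua] _] /set_mem[[_ Ub] _] ab.
    by rewrite -(K2 a)// ab K2.
  + move=> a b /set_mem[[Ua _] _] /set_mem[[Ub _] _] ab.
    by rewrite -(K1 a)// ab K1.
- by split.
Qed.

(** The section inverts the source map on [V], with default value [x] off its image; it is
    continuous at [gsrc x] because the source map is open. *)
Lemma bisection_section (V : set G) (x : G) : bisection V -> V x ->
  exists sg : gobj G -> G, [/\ sg (gsrc x) = x,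
    \forall v \near gsrc x, V (sg v) /\ gsrc (sg v) = v &
    sg v @[v --> gsrc x] --> x].
Proof.
move=> [oV Vs Vr] Vx.
pose sg v := xget x [set y | V y /\ gsrc y = v].
have sgP y : V y -> sg (gsrc y) = y.
  move=> Vy; have [] := @xgetPex _ x [set z | V z /\ gsrc z = gsrc y] (ex_intro _ y (conj Vy erefl)).
  by rewrite -/(sg (gsrc y)) => Vsg /Vs; rewrite !inE; apply.
have nV W : open W -> W `<=` V -> W x -> nbhs (gsrc x) (@gsrc G @` W).
  move=> oW WV Wx; apply: open_nbhs_nbhs; split; last by exists x.
  exact: local_homeomorphism_open G_etale.2 oW.
exists sg; split; first exact: sgP.
- by apply: filterS (nV V oV (@subset_refl _ _) Vx) => _ [y Vy <-]; rewrite sgP.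
- move=> B; rewrite nbhsE => -[B' [oB' B'x] B'B].
  apply: filterS (nV (V `&` B') _ _ _); [|exact: openI|by move=> ? []|by []].
  by move=> _ [y [Vy B'y] <-] /=; rewrite sgP//; exact: B'B.
Qed.

Lemma cvg_gmul (T : Type) (F : set_system T) (FF : Filter F) (f g : T -> G) (a b : G) :
  gsrc a = grng b -> (\forall x \near F, gsrc (f x) = grng (g x)) ->
  f x @[x --> F] --> a -> g x @[x --> F] --> b ->
  gmul (f x) (g x) @[x --> F] --> gmul a b.
Proof.
move=> ab fg fa gb U Uab.
have /subspace_continuousP := @gmul_continuous G.
move=> /(_ (a, b) ab U Uab) /= h.
have := cvg_pair fa gb h => /= h2.
have {}h2 := h2 FF (nbhs_filter _) (nbhs_filter _); apply: filterS2 fg h2 => x /= e; exact.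
Qed.

(** In a bisection [V] around a unit, any nearby [y] has its unit [gunit (gsrc y)] in [V] too; both
    have the same source, so [y] is that unit. *)
Lemma open_range_gunit : open (range (@gunit G)).
Proof.
rewrite openE => _ [u _ <-]; rewrite /interior.
have [V [[oV Vs _] Vu _]] := bisection_basis (@filterT _ _ (nbhs_filter (gunit u : G))).
apply: (@filterS _ _ _ (V `&` (@gunit G \o @gsrc G) @^-1` V)).
  move=> y [Vy Vsy]; exists (gsrc y) => //.
  by apply: Vs; rewrite ?inE// gsrc_unit.
apply: filterI; first exact: open_nbhs_nbhs.
have /continuous_comp : {for (gunit u : G), continuous (@gsrc G)} by exact: gsrc_continuous.
move=> /(_ _ (@gunit G)) h; apply: h; first exact: gunit_continuous.
by rewrite /= gsrc_unit; exact: open_nbhs_nbhs.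
Qed.

Lemma IntIso_unit u : IntIso (gunit u : G).
Proof.
apply: (@filterS _ _ _ (range (@gunit G))).
  by move=> _ [v _ <-]; rewrite /Iso/= gsrc_unit grng_unit.
by apply: open_nbhs_nbhs; split; [exact: open_range_gunit|exists u].
Qed.

Lemma IntIsoE (x : G) : IntIso x -> grng x = gsrc x.
Proof. by move/interior_subset. Qed.

Lemma open_IntIso : open (@IntIso G).
Proof. exact: open_interior. Qed.

Lemma gsrc_section_cvg (sg : gobj G -> G) (x y : G) : gsrc x = gsrc y ->
  sg v @[v --> gsrc x] --> x -> sg (gsrc z) @[z --> y] --> x.
Proof.
by move=> xy sgx; apply: (cvg_comp (@gsrc G) sg _ sgx); rewrite xy; exact: gsrc_continuous.
Qed.

(** Let [sg] be a local section through [y] inside the isotropy. For [z] near [x y], the product of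
    [z] with the inverse of [sg (gsrc z)] is near [x], hence isotropic, and then so is [z]. *)
Lemma IntIso_mul (x y : G) : IntIso x -> IntIso y -> gsrc x = grng y ->
  IntIso (gmul x y).
Proof.
move=> Ix Iy xy; have sxy : gsrc y = gsrc (gmul x y) by rewrite gsrc_mul.
have [V [Vb Vy VI]] := bisection_basis (open_nbhs_nbhs (conj open_IntIso Iy)).
have [sg [sgy sgV sgc]] := bisection_section Vb Vy.
have sgz := gsrc_section_cvg sxy sgc.
have nV : \forall z \near gmul x y, V (sg (gsrc z)) /\ gsrc (sg (gsrc z)) = gsrc z.
  have : gsrc z @[z --> gmul x y] --> gsrc y by rewrite sxy; exact: gsrc_continuous.
  by move=> /(_ _ sgV).
have h : gmul z (ginv (sg (gsrc z))) @[z --> gmul x y] --> gmul (gmul x y) (ginv y).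
  apply: cvg_gmul; [by rewrite grng_inv| |exact: cvg_id|].
    by apply: filterS nV => z [_]; rewrite grng_inv.
  exact: continuous_cvg (@ginv_continuous G y) sgz.
rewrite gmulK// in h.
have := h _ (open_nbhs_nbhs (conj open_IntIso Ix)) => /= h2.
apply: filterS2 nV h2 => z [/VI/IntIsoE rs e] /IntIsoE.
rewrite grng_mul ?grng_inv// gsrc_mul ?grng_inv// gsrc_inv => ez.
by rewrite /Iso /= ez rs e.
Qed.

Lemma IntIso_inv (x : G) : IntIso x -> IntIso (ginv x).
Proof.
rewrite -{1}(ginvK x) => Ix.
have h : \forall z \near ginv x, IntIso (ginv z) :=
  @ginv_continuous G (ginv x) _ (open_nbhs_nbhs (conj open_IntIso Ix)).
apply: filterS h => z /IntIsoE; rewrite grng_inv gsrc_inv => e.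
by rewrite /Iso /= e.
Qed.

(** Let [sg] be a local section through [x] with values in a bisection. For [z] near [x^-1 y x], the
    element [sg (grng z) z (sg (gsrc z))^-1] is near [y], hence isotropic; so the two values of [sg]
    have equal ranges and coincide, which gives [grng z = gsrc z]. *)
Lemma IntIso_conj (x y : G) : IntIso y -> gsrc y = grng x ->
  IntIso (gmul (ginv x) (gmul y x)).
Proof.
move=> Iy yx; have ry := IntIsoE Iy.
set w := gmul _ _.
have c : gsrc (ginv x) = grng (gmul y x) by rewrite gsrc_inv grng_mul// ry yx.
have sw : gsrc w = gsrc x by rewrite /w !gsrc_mul.
have rw : grng w = gsrc x by rewrite /w grng_mul// grng_inv.
have [V [Vb Vx _]] := bisection_basis (@filterT _ _ (nbhs_filter x)).
have [sg [sgx sgV sgc]] := bisection_section Vb Vx.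
have sgs : sg (gsrc z) @[z --> w] --> x.
  exact: gsrc_section_cvg.
have sgr : sg (grng z) @[z --> w] --> x.
  by apply: (cvg_comp (@grng G) sg _ sgc); rewrite -rw; exact: grng_continuous.
have nVs : \forall z \near w, V (sg (gsrc z)) /\ gsrc (sg (gsrc z)) = gsrc z.
  have : gsrc z @[z --> w] --> gsrc x by rewrite -sw; exact: gsrc_continuous.
  by move=> /(_ _ sgV).
have nVr : \forall z \near w, V (sg (grng z)) /\ gsrc (sg (grng z)) = grng z.
  have : grng z @[z --> w] --> gsrc x by rewrite -rw; exact: grng_continuous.
  by move=> /(_ _ sgV).
have h : gmul (gmul (sg (grng z)) z) (ginv (sg (gsrc z))) @[z --> w]
    --> gmul (gmul x w) (ginv x).
  apply: cvg_gmul; [by rewrite gsrc_mul ?grng_inv| | |].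
  - by apply: filterS2 nVs nVr => z [_ e1] [_ e2]; rewrite gsrc_mul ?grng_inv.
  - apply: cvg_gmul => //.
    by apply: filterS nVr => z [_].
  - exact: continuous_cvg (@ginv_continuous G x) sgs.
have e : gmul (gmul x w) (ginv x) = y.
  by rewrite /w gmulVKl ?gmulK// grng_mul// ry yx.
rewrite e in h; have := h _ (open_nbhs_nbhs (conj open_IntIso Iy)) => /= h2.
near=> z.
have [V1 e1] : V (sg (gsrc z)) /\ gsrc (sg (gsrc z)) = gsrc z by near: z.
have [V2 e2] : V (sg (grng z)) /\ gsrc (sg (grng z)) = grng z by near: z.
have /IntIsoE : IntIso (gmul (gmul (sg (grng z)) z) (ginv (sg (gsrc z)))) by near: z.
rewrite grng_mul ?gsrc_mul ?grng_inv ?gsrc_inv ?grng_mul// => rr.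
case: Vb => _ _ /(_ _ _ (mem_set V2) (mem_set V1) rr) e3.
by rewrite /Iso /= -e1 -e2 e3.
Unshelve. all: by end_near.
Qed.

(** Each point has a bisection as neighbourhood, and a bisection meets a source fibre at most
    once. *)
Lemma compact_fiber_finite (K : set G) u : compact K -> finite_set (K `&` fiber u).
Proof.
move=> cK; apply: (compact_finite_discrete cK) => [x []//|x Kx].
have [V [[oV Vs _] Vx _]] := bisection_basis (@filterT _ _ (nbhs_filter x)).
exists V; first exact: open_nbhs_nbhs.
have [[y [[Ky sy] Vy]]|n] := pselect (exists y, (K `&` fiber u `&` V) y); last first.
  by rewrite (_ : _ `&` _ = set0)//; apply/seteqP; split => // y h; apply: n; exists y.
apply: sub_finite_set (finite_set1 y) => z [[Kz sz] Vz] /=.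
by apply: Vs; rewrite ?inE// sz sy.
Qed.

End GroupoidTopology.

(** * Continuous functions with compact support *)

Lemma conjC_continuous (C : numClosedFieldType) :
  continuous (Num.conj : (C : numFieldType) -> (C : numFieldType)).
Proof.
move=> z; apply/(@cvgrPdist_lt C (C : numFieldType) _ (nbhs z)) => e e0.
have /(@cvgrPdist_lt C (C : numFieldType) _ (nbhs z)) h :=
  @cvg_id _ (nbhs (z : (C : numFieldType))).
by apply: filterS (h _ e0) => w; rewrite -rmorphB norm_conjC.
Qed.

Section CompactSupport.
Variables (R : realType) (X : topologicalType).
Hypothesis X_hausdorff : hausdorff_space X.
Implicit Types f g : X -> cplx R.

Lemma real_complex_continuous : continuous (fun r : R => r%:C%C : cplx R).
Proof.
move=> z; apply/(@cvgrPdist_lt R[i] (cplx R) _ (nbhs z)) => e e0.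
have [r _ er] := ger0_cplxP (ltW e0); subst e.
have r0 : 0 < r by rewrite -ltcR.
have /(@cvgrPdist_lt R R _ (nbhs z)) h := @cvg_id _ (nbhs z).
apply: filterS (h _ r0) => w.
by rewrite -rmorphB /= normc_def /= expr0n addr0 sqrtr_sqr ltcR.
Qed.

Lemma CcP f (K : set X) : continuous f -> compact K ->
  (forall x, f x != 0 -> K x) -> Cc f.
Proof.
move=> fc cK fK; split => //; apply: (subclosed_compact _ cK); first exact: closed_closure.
have /closure_id -> := compact_closed X_hausdorff cK.
by apply: closureS => x /fK.
Qed.

Lemma Cc_support f : Cc f -> exists K, compact K /\ forall x, f x != 0 -> K x.
Proof.
by move=> [_ cf]; exists (closure [set x | f x != 0]); split => // x fx; apply: subset_closure.
Qed.

Lemma Cc_lin (c : R[i]) f g : Cc f -> Cc g -> Cc (fun t => c * f t + g t).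
Proof.
move=> Cf Cg; have [K [cK fK]] := Cc_support Cf; have [L [cL gL]] := Cc_support Cg.
apply: (@CcP _ (K `|` L)); last first.
- move=> x h; apply: contrapT => /not_orP[nK nL]; move: h.
  have -> : f x = 0 by apply/eqP; apply: contra_notT nK; exact: fK.
  have -> : g x = 0 by apply/eqP; apply: contra_notT nL; exact: gL.
  by rewrite mulr0 addr0 eqxx.
- exact: compactU.
- move=> x; apply: cvgD; last exact: Cg.1.
  by apply: cvgM; [exact: cvg_cst|exact: Cf.1].
Qed.

Lemma Cc0 : Cc (fun _ : X => 0 : cplx R).
Proof.
apply: (@CcP _ set0); first by move=> x; exact: cvg_cst.
- exact: compact0.
- by move=> x; rewrite eqxx.
Qed.

Lemma Cc_sum (I : Type) (r : seq I) (c : I -> R[i]) (F : I -> X -> cplx R) :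
  (forall i, Cc (F i)) -> Cc (fun t => \sum_(i <- r) c i * F i t).
Proof.
move=> CF; elim: r => [|i r IH].
  by under eq_fun do rewrite big_nil; exact: Cc0.
by under eq_fun do rewrite big_cons; exact: Cc_lin.
Qed.

Lemma Cc_mul f g : Cc f -> Cc g -> Cc (fun t => f t * g t).
Proof.
move=> Cf Cg; have [K [cK fK]] := Cc_support Cf.
apply: (@CcP _ K) => //; last by move=> x; rewrite mulf_eq0 negb_or => /andP[/fK].
by move=> x; apply: cvgM; [exact: Cf.1|exact: Cg.1].
Qed.

(** Local compactness gives complete regularity; the function is separated inside [V] intersected
    with a compact neighbourhood [B], which makes its support compact. *)
Lemma Cc_bump (x : X) (V : set X) : locally_compact [set: X] -> nbhs x V ->
  exists n : X -> cplx R,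
    [/\ Cc n, n x = 1, forall y, ~ V y -> n y = 0 & forall y, (n y)^* = n y].
Proof.
move=> Xlc Vx; have [B Bx [cB _]] := Xlc x I.
have {}Bx : nbhs x B by have := Bx; rewrite /within /=; apply: filterS => y; exact.
have sep : uniform_separator [set x] (~` (V `&` B)°).
  apply: (locally_compact_completely_regular (R := R)) => //.
    exact/open_closedC/open_interior.
  by apply; exact: filterI.
have [f [fc f01 f0 f1]] := (@uniform_separatorP X R _ _).1 sep.
have fx : f x = 0 by apply: f0; exists x.
have fy y : ~ (V `&` B) y -> f y = 1.
  by move=> n; apply: f1; exists y => //; apply: contra_not n => /interior_subset.
exists (fun y => (1 - f y)%:C%C : cplx R); split.
- apply: (@CcP _ B) => //.
    move=> y; apply: continuous_comp; last exact: real_complex_continuous.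
    by apply: cvgB; [exact: cvg_cst|exact: fc].
  by move=> y; apply: contra_neqP => nB; rewrite fy ?subrr// => -[].
- by rewrite fx subr0.
- by move=> y nV; rewrite fy ?subrr// => -[].
- by move=> y; apply/CrealP/complex_realP; exists (1 - f y).
Qed.

End CompactSupport.

(** * Stability of [Cc] under involution and convolution *)

Section ConvolutionAlgebra.
Variables (R : realType) (G : groupoid).
Hypothesis G_hausdorff : hausdorff_space G.
Hypothesis G_etale : etale G.
Implicit Types f g : G -> cplx R.

Lemma Cc_fiber_finite f u : Cc f -> finite_set [set x | fiber u x /\ f x != 0].
Proof.
move=> /Cc_support [K [cK fK]].
by apply: sub_finite_set (compact_fiber_finite G_etale u cK) => x [sx /fK].
Qed.

Lemma Cc_invol f : Cc f -> Cc (invol f).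
Proof.
move=> Cf; have [K [cK fK]] := Cc_support Cf.
apply: (@CcP _ _ G_hausdorff _ (@ginv G @` K)).
- move=> x; apply: continuous_comp; last exact: conjC_continuous.
  by apply: continuous_comp; [exact: ginv_continuous|exact: Cf.1].
- apply: continuous_compact => //; apply: continuous_subspaceT.
  exact: ginv_continuous.
- move=> x; rewrite /invol conjC_eq0 => /fK Kx; exists (ginv x) => //.
  exact: ginvK.
Qed.

Lemma closed_composable : closed [set p : G * G | gsrc p.1 = grng p.2].
Proof.
move=> p clp; apply: gobj_hausdorff => // A B sA rB.
have : nbhs p ((@gsrc G \o fst) @^-1` A `&` (@grng G \o snd) @^-1` B).
  apply: filterI.
    have /continuous_comp : {for p, continuous (@fst G G)} by exact: cvg_fst.
    by move=> /(_ _ (@gsrc G)) h; apply: h => //; exact: gsrc_continuous.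
  have /continuous_comp : {for p, continuous (@snd G G)} by exact: cvg_snd.
  by move=> /(_ _ (@grng G)) h; apply: h => //; exact: grng_continuous.
move=> /clp [q /= [e [Aq Bq]]]; exists (gsrc q.1); split => //.
by rewrite e.
Qed.

Lemma cvg_seq_sum (K : numFieldType) (T I : Type) (F : set_system T) (FF : Filter F)
    (r : seq I) (h : I -> T -> K) (l : I -> K) :
  (forall i, h i x @[x --> F] --> l i) ->
  \sum_(i <- r) h i x @[x --> F] --> \sum_(i <- r) l i.
Proof.
move=> hl; elim: r => [|i r IH].
  rewrite big_nil; under eq_cvg do rewrite big_nil; exact: cvg_cst.
by rewrite big_cons; under eq_cvg do rewrite big_cons; exact: cvgD.
Qed.

(* Near a point [x] of source [u], the sum over the fibre of [gsrc z] runs over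
   the values at [gsrc z] of finitely many continuous local sections, one
   through each point of the support of [g] above [u]. *)
Lemma conv_continuous f g : Cc f -> Cc g -> continuous (conv f g).
Proof.
move=> Cf [gc]; set L := closure _ => cL x.
have gL y : g y != 0 -> L y by move=> gy; apply: subset_closure.
set u := gsrc x; pose T := L `&` fiber u.
have finT : finite_set T := compact_fiber_finite G_etale u cL.
pose D : {fset G} := fset_set T.
have TD b : (b \in D) = (b \in T) by rewrite in_fset_set.
have /choice [V] : forall b : G, exists V, bisection V /\ V b.
  move=> b; have [V [Vb Vx _]] := bisection_basis G_etale (@filterT _ _ (nbhs_filter b)).
  by exists V.
move=> /all_and2[Vbis Vb].
have /choice [sg sgP] := fun b => bisection_section G_etale (Vbis b) (Vb b).
have su b : b \in D -> gsrc b = u by rewrite TD inE => -[].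
have N1 : \forall v \near u, forall b, b \in D -> V b (sg b v) /\ gsrc (sg b v) = v.
  have := @filter_bigI _ _ D (fun b v => V b (sg b v) /\ gsrc (sg b v) = v) (nbhs u) _.
  by apply=> b bD; have [_ + _] := sgP b; rewrite (su b bD).
(* Sections through different points take different values near [u], by the Hausdorff property; this
   makes the later reindexing injective. *)
have N2 : \forall v \near u, forall b, b \in D -> forall c, c \in D -> b != c -> sg b v != sg c v.
  have := @filter_bigI _ _ D (fun b v => forall c, c \in D -> b != c -> sg b v != sg c v) (nbhs u) _.
  apply=> b bD.
  have := @filter_bigI _ _ D (fun c v => b != c -> sg b v != sg c v) (nbhs u) _.
  apply=> c cD; have [->|bc] := eqVneq b c; first by apply: filterE.
  move: G_hausdorff; rewrite open_hausdorff => /(_ b c bc) [[A B] /= [Ab Bc] [oA oB AB]].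
  have [_ _] := sgP b; have [_ _] := sgP c; rewrite (su b bD) (su c cD).
  move=> /(_ _ (open_nbhs_nbhs (conj oB (set_mem Bc)))) h1.
  move=> /(_ _ (open_nbhs_nbhs (conj oA (set_mem Ab)))) h2.
  near=> v; move=> _; apply/eqP => e.
  have Av : A (sg b v) by near: v.
  have Bv : B (sg c v) by near: v.
  by move/eqP : AB; apply/eqP/set0P; exists (sg b v); split => //; rewrite e.
have N3 : \forall v \near u, forall y, L y -> gsrc y = v -> exists2 b, b \in D & V b y.
  (* The part of the support outside the chosen bisections has compact, hence closed, image under
     the source map, and this image misses [u]. *)
  pose L' := L `&` ~` \bigcup_(b in T) V b.
  have cL' : compact (@gsrc G @` L').
    apply: continuous_compact.
      by apply: continuous_subspaceT; exact: gsrc_continuous.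
    apply: compact_closedI => //; apply: open_closedC; apply: bigcup_open => b _.
    by have [] := Vbis b.
  have := compact_closed (gobj_hausdorff G_hausdorff) cL' => /closed_openC oL'.
  have : nbhs u (~` (@gsrc G @` L')).
    apply: open_nbhs_nbhs; split => // -[y [Ly nV] syu].
    by apply: nV; exists y => //; split.
  apply: filterS => v nv y Ly syv; apply: contrapT => n; apply: nv.
  exists y => //; split => // -[b Tb Vby]; apply: n; exists b => //.
  by rewrite TD inE.
pose F z := \sum_(b <- D) f (gmul z (ginv (sg b (gsrc z)))) * g (sg b (gsrc z)).
have convF : \forall z \near x, conv f g z = F z.
  have near_src (P : set (gobj G)) : nbhs u P -> \forall z \near x, P (gsrc z).
    exact: gsrc_continuous.
  apply: filterS3 (near_src _ N1) (near_src _ N2) (near_src _ N3) => z n1 n2 n3.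
  rewrite convE.
  have sgI : set_inj [set` D] (fun b => sg b (gsrc z)).
    move=> b c /set_mem /= bD /set_mem /= cD e; apply/eqP; apply: contra_eqT e => bc.
    exact: n2.
  have -> : F z = \sum_(y \in (fun b => sg b (gsrc z)) @` [set` D])
      f (gmul z (ginv y)) * g y.
    by rewrite fsbig_image// /F [LHS]fsbig_seq ?fset_uniq.
  apply/esym/fsbig_widen => [_ /= [b bD <-]|y [sy ny] /=].
    by have [] := n1 b bD.
  have [gy|/gL Ly] := eqVneq (g y) 0; first by rewrite gy mulr0.
  case: ny; have [b bD Vby] := n3 y Ly sy; exists b => //.
  have [V1 e1] := n1 b bD; have [_ Vs _] := Vbis b.
  by apply: Vs; rewrite ?inE// e1.
have e0 : conv f g x = F x := nbhs_singleton convF.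
rewrite /continuous_at e0; apply: cvg_trans.
  by apply: near_eq_cvg; apply: filterS convF => z ->.
(* Extended by 0 outside [D], so that a limit exists for every index, as [cvg_seq_sum] requires. *)
pose h b z : cplx R := if b \in D then
  f (gmul z (ginv (sg b (gsrc z)))) * g (sg b (gsrc z)) else 0.
have FE : F = fun z => \sum_(b <- D) h b z.
  apply/funext => z; rewrite /F big_seq [RHS]big_seq; apply: eq_bigr => b bD.
  by rewrite /h bD.
rewrite FE; apply: (@cvg_seq_sum _ _ _ _ _ D h (fun b => h b x)) => b.
rewrite /h; case: ifPn => bD; last exact: cvg_cst.
have [sgb sgV sgc] := sgP b; rewrite (su b bD) in sgb sgV sgc.
have sgz : sg b (gsrc z) @[z --> x] --> b.
  by apply: gsrc_section_cvg; rewrite (su b bD).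
rewrite -/u sgb; apply: cvgM; last exact: continuous_cvg (gc b) sgz.
apply: continuous_cvg; first exact: Cf.1.
apply: cvg_gmul; [by rewrite grng_inv (su b bD)| |exact: cvg_id|].
  have : \forall z \near x, V b (sg b (gsrc z)) /\ gsrc (sg b (gsrc z)) = gsrc z.
    by have := @gsrc_continuous G x _ sgV.
  by apply: filterS => z [_]; rewrite grng_inv.
exact: continuous_cvg (@ginv_continuous G b) sgz.
Unshelve. all: by end_near.
Qed.

Lemma Cc_conv f g : Cc f -> Cc g -> Cc (conv f g).
Proof.
move=> Cf Cg; have [K [cK fK]] := Cc_support Cf; have [L [cL gL]] := Cc_support Cg.
pose A := [set p : G * G | gsrc p.1 = grng p.2].
apply: (@CcP _ _ G_hausdorff _ ((fun p => gmul p.1 p.2) @` ((K `*` L) `&` A))).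
- exact: conv_continuous.
- apply: continuous_compact.
    by apply: continuous_subspaceW (@gmul_continuous G) => p [].
  by apply: compact_closedI; [exact: compact_setX|exact: closed_composable].
- move=> x; rewrite convE; apply: contra_neqP => n; apply: fsbig1 => b sb.
  have [->|/fK Kx] := eqVneq (f (gmul x (ginv b))) 0; first by rewrite mul0r.
  have [->|/gL Lb] := eqVneq (g b) 0; first by rewrite mulr0.
  case: n; exists (gmul x (ginv b), b) => /=; last by rewrite gmulVK.
  by split => //; rewrite /A /= gsrc_mul ?grng_inv// gsrc_inv.
Qed.

End ConvolutionAlgebra.

(** * Finite sums and norms *)

Section FiniteSums.
Variables (I : choiceType) (K : numFieldType).
Implicit Types (A : set I) (f g : I -> K).

Lemma fsum_seqE A (r : seq I) f : uniq r -> {in r, forall i, A i} ->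
  (forall i, A i -> i \notin r -> f i = 0) ->
  \sum_(i \in A) f i = \sum_(i <- r) f i.
Proof.
move=> ur rA f0; rewrite (fsbigE r)//.
rewrite big_mkcond big_seq [RHS]big_seq; apply: eq_bigr => i ir.
by rewrite ifT// inE; exact: rA.
Qed.

(** The finite supports matter: a sum with infinite support is 0 by convention. *)
Lemma fsumD A f g : finite_set [set i | A i /\ f i != 0] ->
  finite_set [set i | A i /\ g i != 0] ->
  \sum_(i \in A) (f i + g i) = \sum_(i \in A) f i + \sum_(i \in A) g i.
Proof.
set F := [set i | _]; set H := [set i | A i /\ g i != 0] => fF fH.
have fFH : finite_set (F `|` H) by rewrite finite_setU.
have w (h : I -> K) : (forall i, A i -> h i != 0 -> (F `|` H) i) ->
    \sum_(i \in A) h i = \sum_(i \in F `|` H) h i.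
  move=> hFH; apply/esym/fsbig_widen => [i [[]|[]]//|i [Ai n] /=].
  by apply/eqP; apply: contra_notT n => /(hFH i Ai).
rewrite w; last first.
  move=> i Ai; apply: contra_neqP => /not_orP[nF nH].
  have -> : f i = 0 by apply/eqP; apply: contra_notT nF.
  have -> : g i = 0 by apply/eqP; apply: contra_notT nH.
  by rewrite addr0.
rewrite (w f); last by move=> i Ai fi; left.
rewrite (w g); last by move=> i Ai fi; right.
exact: fsbig_split.
Qed.

Lemma fsum_exchange A (J : eqType) (r : seq J) (f : J -> I -> K) :
  (forall j, j \in r -> finite_set [set i | A i /\ f j i != 0]) ->
  \sum_(i \in A) \sum_(j <- r) f j i = \sum_(j <- r) \sum_(i \in A) f j i.
Proof.
elim: r => [|j r IH] fr.
  by rewrite big_nil fsbig1// => i _; rewrite big_nil.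
have frr k : k \in r -> finite_set [set i | A i /\ f k i != 0].
  by move=> kr; apply: fr; rewrite inE kr orbT.
rewrite big_cons -(IH frr) -fsumD.
- by apply: eq_fsbigr => i _; rewrite big_cons.
- by apply: fr; rewrite inE eqxx.
have : finite_set (\bigcup_(k in [set` r]) [set i | A i /\ f k i != 0]).
  by apply: bigcup_finite => //= k /= /frr.
apply: sub_finite_set => i [Ai]; apply: contra_neqP => n.
rewrite big_seq big1// => k kr; apply/eqP; apply: contra_notT n => fk.
by exists k.
Qed.

End FiniteSums.

Section Norms.
Variable R : realType.

Lemma rnormE (V : normedModType R[i]) (x : V) : `|x| = (rnorm x)%:C%C.
Proof. by rewrite /rnorm RRe_real// normr_real. Qed.

Lemma rnorm_ge0 (V : normedModType R[i]) (x : V) : 0 <= rnorm x.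
Proof. by rewrite -ler0c -rnormE normr_ge0. Qed.

Lemma closure_approx (V : normedModType R[i]) (S : set V) (b : V) (e : R) :
  0 < e -> closure S b -> exists2 s, S s & rnorm (b - s) < e.
Proof.
move=> e0; have ec : 0 < e%:C%C by rewrite ltcR.
move=> /(_ _ (nbhsx_ballx b _ ec)) [s [Ss]].
by rewrite -ball_normE /ball_ /= rnormE ltcR => h; exists s.
Qed.

Lemma dense_approx (V : normedModType R[i]) (S : set V) (b : V) (e : R) :
  0 < e -> dense S -> exists2 s, S s & rnorm (b - s) < e.
Proof.
move=> e0 dS; apply: closure_approx => // B; rewrite nbhsE => -[U [oU Ub] UB].
have [s [Us Ss]] := dS U (ex_intro _ b Ub) oU.
by exists s; split => //; exact: UB.
Qed.

Variable A : cstarAlgebra R.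
Implicit Types x y : A.

(** The C*-identity bounds the square of [|y|] by [|y^*| |y|]; apply this to [x] and to its
    adjoint. *)
Lemma cs_norm_star x : `|cs_star x| = `|x|.
Proof.
have h y : `|y| <= `|cs_star y|.
  have [->|y0] := eqVneq y 0; first by rewrite normr0.
  have ny : 0 < `|y| by rewrite normr_gt0.
  by rewrite -(ler_pM2r ny) -expr2 -cs_normC cs_normM.
by apply/eqP; rewrite eq_le h andbT -{2}(cs_starK x) h.
Qed.

Lemma cs_mulBl x y z : cs_mul (x - y) z = cs_mul x z - cs_mul y z :> A.
Proof. by rewrite cs_mulDl -scaleN1r cs_mulZl scaleN1r. Qed.

Lemma cs_mulBr x y z : cs_mul z (x - y) = cs_mul z x - cs_mul z y :> A.
Proof. by rewrite cs_mulDr -scaleN1r cs_mulZr scaleN1r. Qed.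

Lemma cs_starB x y : cs_star (x - y) = cs_star x - cs_star y.
Proof. by rewrite cs_starD -scaleN1r cs_starZ conjCN1 scaleN1r. Qed.

Lemma cs_mul0r x : cs_mul 0 x = 0.
Proof. by rewrite -{1}(subrr (0 : A)) cs_mulBl subrr. Qed.

Lemma cs_mulr0 x : cs_mul x 0 = 0.
Proof. by rewrite -{1}(subrr (0 : A)) cs_mulBr subrr. Qed.

Lemma rnorm_mul x y : rnorm (cs_mul x y) <= rnorm x * rnorm y.
Proof. by rewrite -lecR rmorphM /= -!rnormE cs_normM. Qed.

Lemma rnormD x y : rnorm (x + y) <= rnorm x + rnorm y.
Proof. by rewrite -lecR rmorphD /= -!rnormE ler_normD. Qed.

Lemma rnorm_star x : rnorm (cs_star x) = rnorm x.
Proof. by rewrite /rnorm cs_norm_star. Qed.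

End Norms.

Lemma pos_scale (R : realType) (k e : R) : 0 <= k -> 0 < e ->
  exists2 d : R, 0 < d & forall t, t < d -> k * t < e.
Proof.
move=> k0 e0; have k1 : 0 < k + 1 by lra.
exists (e / (k + 1)); first exact: divr_gt0.
move=> t; rewrite ltr_pdivlMr// => td.
have [t0|t0] := leP t 0; first by apply: le_lt_trans e0; rewrite mulr_ge0_le0.
by nra.
Qed.

(** * Summation over the isotropy group *)

Section IsotropySum.
Variables (R : realType) (G : groupoid).
Hypothesis G_locally_compact : locally_compact [set: G].
Hypothesis G_hausdorff : hausdorff_space G.
Hypothesis G_etale : etale G.
Variable u0 : gobj G.
Notation S := (@IntIso_at G u0).
Implicit Types f g : G -> cplx R.

Lemma IntIso_at_src x : S x -> gsrc x = u0. Proof. by case. Qed.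

Lemma IntIso_at_rng x : S x -> grng x = u0.
Proof. by move=> [/IntIsoE -> ->]. Qed.

Lemma IntIso_at_mul x y : S x -> S y -> S (gmul x y).
Proof.
move=> Sx Sy; have xy : gsrc x = grng y by rewrite IntIso_at_src ?IntIso_at_rng.
split; last by rewrite gsrc_mul// IntIso_at_src.
by apply: IntIso_mul => //; [case: Sx|case: Sy].
Qed.

Lemma IntIso_at_inv x : S x -> S (ginv x).
Proof.
by move=> Sx; split; [apply: IntIso_inv; case: Sx|rewrite gsrc_inv IntIso_at_rng].
Qed.

Lemma IntIso_at_translate c : S c -> set_bij S S (fun x => gmul x c).
Proof.
move=> Sc; have comp x : S x -> gsrc x = grng c.
  by move=> Sx; rewrite IntIso_at_src// IntIso_at_rng.
split=> [x Sx|x y /set_mem Sx /set_mem Sy e|x Sx].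
- exact: IntIso_at_mul.
- by rewrite -(gmulK (comp x Sx)) e gmulK// comp.
- exists (gmul x (ginv c)); first by apply: IntIso_at_mul => //; exact: IntIso_at_inv.
  by apply: gmulVK; rewrite !IntIso_at_src.
Qed.

(** On functions on the group [S] this is the augmentation, that is, the trivial representation. *)
Definition isotropy_sum f : R[i] := \sum_(x \in S) f x.
Notation phi := isotropy_sum.

Lemma Cc_translate_finite f b : Cc f -> gsrc b = u0 ->
  finite_set [set x | S x /\ f (gmul x (ginv b)) != 0].
Proof.
move=> Cf bu; have := Cc_fiber_finite G_etale (grng b) Cf.
move=> /(finite_image (fun y => gmul y b)); apply: sub_finite_set => x [Sx fx].
exists (gmul x (ginv b)); last by rewrite gmulVK// IntIso_at_src.
by rewrite /fiber /= gsrc_mul ?gsrc_inv// grng_inv bu IntIso_at_src.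
Qed.

Lemma Cc_isotropy_finite f : Cc f -> finite_set [set x | S x /\ f x != 0].
Proof.
move=> Cf; apply: sub_finite_set (Cc_fiber_finite G_etale u0 Cf) => x [Sx fx].
by split => //; exact: IntIso_at_src.
Qed.

Lemma isotropy_sum_lin (c : R[i]) f g : Cc f -> Cc g ->
  phi (fun t => c * f t + g t) = c * phi f + phi g.
Proof.
move=> Cf Cg; rewrite /phi fsumD; first by rewrite mulr_fsumr.
- apply: sub_finite_set (Cc_isotropy_finite Cf) => x [Sx cf]; split => //.
  by apply: contra_neq cf => ->; rewrite mulr0.
- exact: Cc_isotropy_finite.
Qed.

(** Exchanging sums, the total over [S] becomes a finite sum over [b] of [g b] times the sum of [f]
    over the coset [S b^-1]. *)
Lemma isotropy_sum_conv f g : Cc f -> Cc g ->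
  (forall b, gsrc b = u0 -> \sum_(x \in S) f (gmul x (ginv b)) = 0) ->
  phi (conv f g) = 0.
Proof.
move=> Cf Cg f0; rewrite /phi.
pose B := [set b | fiber u0 b /\ g b != 0].
have fB : finite_set B by exact: Cc_fiber_finite.
pose r : seq G := finmap.enum_fset (fset_set B).
have rB b : (b \in r) = (b \in B) by rewrite -in_fset_set.
have -> : \sum_(x \in S) conv f g x =
    \sum_(x \in S) \sum_(b <- r) f (gmul x (ginv b)) * g b.
  apply: eq_fsbigr => x /set_mem Sx; rewrite convE IntIso_at_src//.
  apply: fsum_seqE; first exact: finmap.fset_uniq.
  - by move=> b; rewrite rB inE => -[].
  - move=> b bu; rewrite rB notin_setE => n.
    have -> : g b = 0 by apply/eqP; apply: contra_notT n.
    by rewrite mulr0.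
rewrite fsum_exchange.
  rewrite big_seq big1// => b; rewrite rB inE => -[bu _].
  by rewrite -mulr_fsuml f0// mul0r.
move=> b; rewrite rB inE => -[bu _].
apply: sub_finite_set (Cc_translate_finite Cf bu) => x [Sx n]; split => //.
by apply: contra_neq n => ->; rewrite mul0r.
Qed.

(** The source fibre of [x] meets [V] only in [x], so a bump function supported in [V] is a point
    mass on that fibre. *)
Lemma bisection_bump (x : G) (W : set G) : nbhs x W -> exists V (n : G -> cplx R),
  [/\ bisection V, V `<=` W & [/\ Cc n, forall y, ~ V y -> n y = 0,
   forall y, (n y)^* = n y & forall y, gsrc y = gsrc x -> n y = (y == x)%:R]].
Proof.
move=> Wx; have [V [Vb Vx VW]] := bisection_basis G_etale Wx.
have [oV Vs _] := Vb.
have [n [Cn nx n0 nr]] := Cc_bump R G_hausdorff G_locally_compact (open_nbhs_nbhs (conj oV Vx)).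
exists V, n; split => //; split => // y yx.
have [->|/eqP yx'] := eqVneq y x; first exact: nx.
by rewrite n0// => Vy; apply: yx'; apply: Vs; rewrite ?inE.
Qed.

(** For real-valued [n] this is [|n|^2 - n^* n], with pointwise square and convolution product, in
    the shape [c f + g] of the linearity lemmas. *)
Definition bundle_defect (n : G -> cplx R) : G -> cplx R :=
  fun t => -1 * conv (invol n) n t + n t * n t.

Lemma Cc_bundle_defect n : Cc n -> Cc (bundle_defect n).
Proof.
move=> Cn; apply: Cc_lin => //; last exact: Cc_mul.
by apply: Cc_conv => //; exact: Cc_invol.
Qed.

(** On this fibre [n] lives at [y] alone, and [n^* n] lives at the unit, where its value is the
    squared l^2 norm of [n] along the fibre. *)
Lemma bundle_defect_fiber (n : G -> cplx R) (V : set G) (y : G) :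
  bisection V -> (forall z, ~ V z -> n z = 0) -> (forall z, (n z)^* = n z) ->
  V y -> forall d, gsrc d = gsrc y ->
  bundle_defect n d = n y * n y * ((d == y)%:R - (d == gunit (gsrc y))%:R).
Proof.
move=> [_ Vs Vr] n0 nr Vy d dy.
have nd b : gsrc b = gsrc y -> b != y -> n b = 0.
  by move=> by_ /eqP yb; apply: n0 => Vb; apply: yb; apply: Vs; rewrite ?inE.
rewrite /bundle_defect mulrBr addrC; congr (_ + _).
  have [->|dny] := eqVneq d y; first by rewrite mulr1.
  by rewrite nd// !mulr0.
rewrite mulN1r; congr (- _).
have [->|du] := eqVneq d (gunit (gsrc y)).
  rewrite conv_invol_unit mulr1 (fsum_seqE (r := [:: y]))//.
  - by rewrite big_seq1 nr.
  - by move=> b; rewrite inE => /eqP ->.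
  - by move=> b bu; rewrite inE => bny; rewrite nd// mulr0.
rewrite mulr0 (@conv_invol_inj _ _ _ _ V)// => -[v _ e].
by move/eqP: du; apply; rewrite -dy -e gsrc_unit.
Qed.

Lemma bundle_defect0 (n : G -> cplx R) (v : gobj G) :
  (forall z, gsrc z = v -> n z = 0) -> (forall d, gsrc d = v -> bundle_defect n d = 0).
Proof.
move=> n0 d dv; rewrite /bundle_defect n0// mulr0 addr0 convE fsbig1 ?mulr0//.
by move=> b bd; rewrite (n0 b) ?mulr0// -dv.
Qed.

(* The two terms of [bundle_defect n] live on a bisection [V] inside the
   isotropy bundle and on its source in the unit space; they cancel because an
   element of [V] and its source have the same image modulo [IntIso]. *)
Lemma bundle_defect_killed (n : G -> cplx R) (V : set G) g h :
  bisection V -> V `<=` @IntIso G ->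
  Cc n -> (forall z, ~ V z -> n z = 0) -> (forall z, (n z)^* = n z) ->
  Cc g -> Cc h -> phi (conv (conv g (bundle_defect n)) h) = 0.
Proof.
move=> Vb VI Cn n0 nr Cg Ch.
apply: isotropy_sum_conv => //.
  by apply: Cc_conv => //; exact: Cc_bundle_defect.
move=> b bu.
have sxb x : S x -> gsrc (gmul x (ginv b)) = grng b.
  by move=> Sx; rewrite gsrc_mul ?gsrc_inv// grng_inv bu IntIso_at_src.
have [[y [Vy yb]]|nV] := pselect (exists y, V y /\ gsrc y = grng b); last first.
  apply: fsbig1 => x Sx; rewrite convE fsbig1// => d; rewrite sxb// => db.
  rewrite (@bundle_defect0 _ (grng b)) ?mulr0// => z zb.
  by apply: n0 => Vz; apply: nV; exists z.
have Iy := VI y Vy.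
have sc : gsrc (gmul y b) = u0 by rewrite gsrc_mul.
have E x : S x -> conv g (bundle_defect n) (gmul x (ginv b)) =
    n y * n y * g (gmul x (ginv (gmul y b))) + - (n y * n y) * g (gmul x (ginv b)).
  move=> Sx; rewrite convE sxb//.
  have xb : gsrc x = grng (ginv b) by rewrite grng_inv bu IntIso_at_src.
  have sz : gsrc (gmul x (ginv b)) = gsrc y by rewrite sxb.
  have szu : gsrc (gmul x (ginv b)) = gsrc (gunit (grng b)) by rewrite sxb// gsrc_unit.
  have zu : gmul (gmul x (ginv b)) (ginv (gunit (grng b))) = gmul x (ginv b).
    by rewrite ginv_unit -(sxb x Sx) gmul_unit.
  have zy : gmul (gmul x (ginv b)) (ginv y) = gmul x (ginv (gmul y b)).
    by rewrite ginvM// gmulA// gsrc_inv grng_inv.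
  have Ed d : fiber (grng b) d ->
    g (gmul (gmul x (ginv b)) (ginv d)) * bundle_defect n d =
    n y * n y * g (gmul (gmul x (ginv b)) (ginv d)) * (d == y)%:R +
    - (n y * n y) * g (gmul (gmul x (ginv b)) (ginv d)) * (d == gunit (grng b))%:R.
    by move=> db; rewrite (bundle_defect_fiber Vb n0 nr Vy) ?yb//; ring.
  have fin1 (k : G) (w : G -> R[i]) : finite_set [set d | fiber (grng b) d /\ w d * (d == k)%:R != 0].
    apply: sub_finite_set (finite_set1 k) => d [_]; apply: contra_neqP => /= dk.
    by rewrite (introF eqP dk) mulr0.
  under eq_fsbigr => d /set_mem db do rewrite Ed//.
  rewrite fsumD//; congr (_ + _).
  - rewrite (fsum_seqE (r := [:: y]))//; first by rewrite big_seq1 eqxx mulr1 zy.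
    + by move=> d; rewrite inE => /eqP ->.
    + by move=> d _; rewrite inE => /negPf ->; rewrite mulr0.
  - rewrite (fsum_seqE (r := [:: gunit (grng b)]))//; first by rewrite big_seq1 eqxx mulr1 zu.
    + by move=> d; rewrite inE => /eqP ->; exact: gsrc_unit.
    + by move=> d _; rewrite inE => /negPf ->; rewrite mulr0.
under eq_fsbigr => x /set_mem Sx do rewrite E//.
have fin (c : G) (a : R[i]) : gsrc c = u0 ->
    finite_set [set x | S x /\ a * g (gmul x (ginv c)) != 0].
  move=> cu; apply: sub_finite_set (Cc_translate_finite Cg cu) => x [Sx n1].
  by split => //; apply: contra_neq n1 => ->; rewrite mulr0.
rewrite fsumD; [|exact: fin|exact: fin].
(* Conjugation by [b] carries [y] into [S], and the translation of [S] by [c] turns the coset sum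
   along [y b] into the one along [b]; the two opposite terms cancel. *)
pose c := gmul (ginv b) (gmul y b).
have byb : gsrc (ginv b) = grng (gmul y b) by rewrite gsrc_inv grng_mul// (IntIsoE Iy).
have Sc : S c.
  split; first by apply: IntIso_conj.
  by rewrite /c gsrc_mul.
rewrite (reindex_fsbig (fun x => gmul x c) _ _ _ (IntIso_at_translate Sc)).
have e x : S x -> gmul (gmul x c) (ginv (gmul y b)) = gmul x (ginv b).
  move=> Sx; have xb : gsrc x = grng (ginv b) by rewrite grng_inv bu IntIso_at_src.
  rewrite /c gmulA// gmulK//.
  by rewrite gsrc_mul.
under eq_fsbigr => x /set_mem Sx do rewrite e//.
rewrite -!mulr_fsumr; ring.
Qed.

End IsotropySum.

(** * The reduced algebra *)

Section ReducedAlgebra.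
Variables (R : realType) (G : groupoid).
Hypothesis G_locally_compact : locally_compact [set: G].
Hypothesis G_hausdorff : hausdorff_space G.
Hypothesis G_etale : etale G.
Variables (A : cstarAlgebra R) (j : (G -> cplx R) -> A).
Variable E : A -> gobj G -> cplx R.
Hypothesis j_full : is_full_cstar j.
Hypothesis E_exp : is_cond_exp j E.
Implicit Types f g : G -> cplx R.

Lemma j_lin (c : R[i]) f g : Cc f -> Cc g ->
  j (fun t => c * f t + g t) = c *: j f + j g.
Proof. by have [+ _ _ _ _] := j_full; apply. Qed.

Lemma j_conv f g : Cc f -> Cc g -> j (conv f g) = cs_mul (j f) (j g).
Proof. by have [_ + _ _ _] := j_full; apply. Qed.

Lemma j_star f : Cc f -> j (invol f) = cs_star (j f).
Proof. by have [_ _ + _ _] := j_full; apply. Qed.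

Lemma j_dense (a : A) (e : R) : 0 < e -> exists2 f, Cc f & rnorm (a - j f) < e.
Proof.
have [_ _ _ _ dj] := j_full => e0.
by have [_ [f Cf <-]] := dense_approx a e0 dj; exists f.
Qed.

Lemma E_lin (c : R[i]) a b u : E (c *: a + b) u = c * E a u + E b u.
Proof. by have [_ + _ _] := E_exp; apply. Qed.

Lemma E_le a u : `|E a u| <= `|a|.
Proof. by have [_ _ + _] := E_exp; apply. Qed.

Lemma E_B a b u : E (a - b) u = E a u - E b u.
Proof. by rewrite -scaleN1r addrC E_lin mulN1r addrC. Qed.

Lemma E_star_mul f g u : Cc f -> Cc g ->
  E (cs_mul (cs_star (j f)) (j g)) u = \sum_(b \in fiber u) (f b)^* * g b.
Proof.
move=> Cf Cg; have [_ _ _ Ej] := E_exp.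
have Ci := Cc_invol G_hausdorff Cf.
by rewrite -j_star// -j_conv// Ej /= ?conv_invol_unit//; exact: Cc_conv.
Qed.

(** On the dense subalgebra the value is a sum of squared moduli, and positivity passes to the
    limit. *)
Lemma E_ge0 a u : 0 <= E (cs_mul (cs_star a) a) u.
Proof.
apply: ge0c_approx => e e0.
(* The factor [2 |a| + 1] bounds [|a| + |j f|] once [j f] is within 1 of [a]. *)
have [d d0 dP] := pos_scale (addr_ge0 (mulr_ge0 (ler0n R 2) (rnorm_ge0 a)) ler01) e0.
have [|f Cf fa] := @j_dense a (Num.min d 1); first by rewrite lt_min d0 ltr01.
move: fa; rewrite lt_min => /andP[fd f1].
exists (E (cs_mul (cs_star (j f)) (j f)) u).
  rewrite E_star_mul//; apply: fsumr_ge0 => b _.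
  by rewrite mulrC mul_conjC_ge0.
rewrite -E_B; apply: le_trans (E_le _ _) _; rewrite rnormE lecR.
apply/ltW; apply: le_lt_trans (dP _ fd).
have -> : cs_mul (cs_star a) a - cs_mul (cs_star (j f)) (j f) =
    cs_mul (cs_star a) (a - j f) + cs_mul (cs_star (a - j f)) (j f).
  by rewrite cs_mulBr cs_starB cs_mulBl addrA subrK.
apply: le_trans (rnormD _ _) _.
apply: le_trans (lerD (rnorm_mul _ _) (rnorm_mul _ _)) _.
rewrite !rnorm_star.
have jf : rnorm (j f) <= rnorm a + rnorm (a - j f).
  have -> : rnorm (a - j f) = rnorm (j f - a) by rewrite /rnorm distrC.
  by apply: le_trans (rnormD _ _); rewrite addrC subrK.
have := rnorm_ge0 a; have := rnorm_ge0 (a - j f); nra.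
Qed.

Lemma E_compression u (a x : A) :
  `|E (cs_mul (cs_star x) (cs_mul a x)) u| <= `|a| * E (cs_mul (cs_star x) x) u.
Proof.
apply: (@psi_le _ _ (fun a => E a u)) => [c b b'|b|b].
- exact: E_lin.
- exact: E_le.
- exact: E_ge0.
Qed.

Variables (Cred : cstarAlgebra R) (q : A -> Cred).
Hypothesis q_quo : is_cstar_quotient (cond_exp_ideal E) q.

Lemma q_lin (c : R[i]) a b : q (c *: a + b) = c *: q a + q b.
Proof. by have [[+ _ _] _ _ _] := q_quo; apply. Qed.

Lemma q_mul a b : q (cs_mul a b) = cs_mul (q a) (q b).
Proof. by have [[_ + _] _ _ _] := q_quo; apply. Qed.

Lemma q_B a b : q (a - b) = q a - q b.
Proof. by rewrite -scaleN1r addrC q_lin scaleN1r addrC. Qed.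

Lemma cond_exp_ideal0 : cond_exp_ideal E 0.
Proof.
move=> x y; apply/funext => u.
by rewrite cs_mulr0 cs_mul0r -(subrr (0 : A)) E_B subrr.
Qed.

Lemma q_norm_has_inf a :
  has_inf [set rnorm (a + k) | k in cond_exp_ideal E].
Proof.
split; first by exists (rnorm (a + 0)), 0 => //; exact: cond_exp_ideal0.
by exists 0 => _ [k _ <-]; exact: rnorm_ge0.
Qed.

Lemma q_le a : rnorm (q a) <= rnorm a.
Proof.
have [_ _ _ ->] := q_quo; apply: ge_inf; first by have [] := q_norm_has_inf a.
by exists 0; [exact: cond_exp_ideal0|rewrite addr0].
Qed.

Lemma q_lift a (e : R) : 0 < e -> exists2 k, cond_exp_ideal E k &
  rnorm (a + k) < rnorm (q a) + e.
Proof.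
move=> e0; have [_ _ _ qE] := q_quo.
have [_ [k Kk <-]] := inf_adherent e0 (q_norm_has_inf a).
by rewrite -qE; exists k.
Qed.

Lemma qj_dense (b : Cred) (e : R) : 0 < e -> exists2 f, Cc f & rnorm (b - q (j f)) < e.
Proof.
move=> e0; have [_ qs _ _] := q_quo; have [a _ <-] := qs b I.
have [f Cf fa] := j_dense a e0; exists f => //.
by rewrite -q_B; exact: le_lt_trans (q_le _) fa.
Qed.

Variable u0 : gobj G.
Hypothesis u0_amenable : amenable_isotropy R (IntIso_at u0).
Notation S := (@IntIso_at G u0).
Notation phi := (@isotropy_sum R G u0).

(** Combining bump functions through the points of [w] gives [X] equal to [xi] on the fibre of [u0].
    The compression is then the matrix coefficient of [f] at [xi], and the substitution
    [b = gmul x y] collects the coefficient of each [f x]. *)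
Lemma E_test_vector (w : seq G) (xi : G -> R) : uniq w -> {in w, forall x, S x} ->
    (forall x, x \notin w -> xi x = 0) ->
  exists X, [/\ Cc X,
    E (cs_mul (cs_star (j X)) (j X)) u0 = (\sum_(x <- w) xi x ^+ 2)%:C%C &
    forall f, Cc f -> E (cs_mul (cs_star (j X)) (cs_mul (j f) (j X))) u0 =
      \sum_(x \in S) f x * (\sum_(y <- w) xi (gmul x y) * xi y)%:C%C].
Proof.
move=> uw wS xi0.
have /choice [n nP] : forall s : G, exists n : G -> cplx R, Cc n /\
    forall y, gsrc y = gsrc s -> n y = (y == s)%:R.
  move=> s; have [V [n [_ _ [Cn _ _ ns]]]] := @bisection_bump R G
    G_locally_compact G_hausdorff G_etale s setT (@filterT _ _ (nbhs_filter s)).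
  by exists n.
pose X t : cplx R := \sum_(s <- w) (xi s)%:C%C * n s t.
have CX : Cc X by apply: Cc_sum => // s; have [] := nP s.
have XE b : fiber u0 b -> X b = (xi b)%:C%C.
  move=> bu; have XE1 : X b = \sum_(s <- w) (xi s)%:C%C * (b == s)%:R.
    rewrite /X big_seq [RHS]big_seq; apply: eq_bigr => s sw.
    by have [_ ->] := nP s => //; rewrite bu (IntIso_at_src (wS s sw)).
  rewrite XE1; have [bw|bw] := boolP (b \in w).
    rewrite (bigD1_seq b)//= eqxx mulr1 big1 ?addr0// => s /negPf sb.
    by rewrite eq_sym sb mulr0.
  rewrite xi0// big_seq big1// => s sw; case: eqP => [bs|]; rewrite ?mulr0//.
  by rewrite bs sw in bw.
have conj_real (r : R) : (r%:C%C)^* = r%:C%C :> R[i].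
  by apply/CrealP/complex_realP; exists r.
have wfib b : b \in w -> fiber u0 b by move=> /wS /IntIso_at_src.
have X0 b : fiber u0 b -> b \notin w -> X b = 0 by move=> bu bw; rewrite XE// xi0.
exists X; split=> // [|f Cf].
  rewrite E_star_mul// (fsum_seqE uw)//; last by move=> b bu bw; rewrite X0// mulr0.
  rewrite rmorph_sum /= big_seq [RHS]big_seq; apply: eq_bigr => b bw.
  by rewrite (XE b (wfib b bw)) conj_real -rmorphM.
rewrite -j_conv// E_star_mul//; last exact: Cc_conv.
rewrite (fsum_seqE uw)//; last by move=> b bu bw; rewrite X0// conjC0 mul0r.
have cE b : b \in w -> conv f X b = \sum_(y <- w) f (gmul b (ginv y)) * X y.
  move=> bw; rewrite convE (wfib b bw) (fsum_seqE uw)// => y yu yw.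
  by rewrite X0// mulr0.
transitivity (\sum_(b <- w) \sum_(y <- w) (xi b)%:C%C * (f (gmul b (ginv y)) * (xi y)%:C%C)).
  rewrite big_seq [RHS]big_seq; apply: eq_bigr => b bw; rewrite cE// (XE b (wfib b bw)) conj_real.
  by rewrite mulr_sumr big_seq [RHS]big_seq; apply: eq_bigr => y yw; rewrite (XE y (wfib y yw)).
rewrite exchange_big /=.
transitivity (\sum_(y <- w) \sum_(x \in S) f x * ((xi (gmul x y))%:C%C * (xi y)%:C%C)).
  rewrite big_seq [RHS]big_seq; apply: eq_bigr => y yw.
  rewrite -(fsum_seqE (A := S) uw)//; last by move=> b Sb bw; rewrite xi0// mul0r.
  rewrite (reindex_fsbig (fun x => gmul x y) _ _ _ (IntIso_at_translate G_etale (wS y yw))).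
  apply: eq_fsbigr => x /set_mem Sx; rewrite gmulK; first by ring.
  by rewrite (IntIso_at_src Sx) (IntIso_at_rng (wS y yw)).
rewrite -fsum_exchange.
  by apply: eq_fsbigr => x _; rewrite rmorph_sum /= mulr_sumr; apply: eq_bigr => y _; rewrite rmorphM.
move=> y yw; apply: sub_finite_set (Cc_isotropy_finite G_etale u0 Cf) => x [Sx n1].
by split => //; apply: contra_neq n1 => ->; rewrite mul0r.
Qed.

(* The trivial representation of the amenable isotropy group is weakly
   contained in its regular representation, so that the isotropy sum is
   controlled by the reduced norm. *)
Lemma isotropy_sum_le f : Cc f -> `|phi f| <= `|q (j f)|.
Proof.
move=> Cf; apply: lec_addgt0P => e e0.
have e20 : 0 < e / 2 by rewrite divr_gt0.
have [k Kk kq] := q_lift (j f) e20.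
have fS := Cc_isotropy_finite G_etale u0 Cf.
pose F : seq G := finmap.enum_fset (fset_set [set x | S x /\ f x != 0]).
have FE x : (x \in F) = (x \in [set x | S x /\ f x != 0]) by rewrite -in_fset_set.
have uF : uniq F by exact: finmap.fset_uniq.
have FS : {in F, forall x, S x} by move=> x; rewrite FE inE => -[].
have f0 x : S x -> x \notin F -> f x = 0.
  move=> Sx; rewrite FE notin_setE => n; apply/eqP; apply: contra_notT n.
  by [].
have nE (z : R[i]) : `|z| = (complex.Re `|z|)%:C%C by rewrite RRe_real// normr_real.
have n0 (z : R[i]) : 0 <= complex.Re `|z| by rewrite -ler0c -nE.
(* The l^1 norm of [f] on [S]: it converts the almost invariance of [xi] into the error [e / 2]. *)
pose M := \sum_(x <- F) complex.Re `|f x|.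
have M0 : 0 <= M by apply: sumr_ge0.
have [d d0 dP] := pos_scale M0 e20.
have d20 : 0 < d / 2 by rewrite divr_gt0.
have [m [m_lin m_ge0 m1 m_inv]] := u0_amenable.
have mulI a x y : S a -> S x -> S y -> gmul a x = gmul a y -> x = y.
  move=> Sa Sx Sy e1.
  have sa z : S z -> gsrc a = grng z.
    by move=> Sz; rewrite (IntIso_at_src Sa) (IntIso_at_rng Sz).
  by rewrite -(gmulKl (sa x Sx)) e1 (gmulKl (sa y Sy)).
have [w [xi [uw wS xi0 xi1 xid]]] :=
  almost_invariant_vector mulI m_lin m_ge0 m1 m_inv uF FS d20.
have [X [CX X1 XE]] := E_test_vector uw wS xi0.
rewrite xi1 in X1.
(* The lift [k] lies in [cond_exp_ideal E], so adding it leaves the compression unchanged while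
   bringing the norm close to the quotient norm. *)
have h1 : `|E (cs_mul (cs_star (j X)) (cs_mul (j f) (j X))) u0| <= `|j f + k|.
  have -> : E (cs_mul (cs_star (j X)) (cs_mul (j f) (j X))) u0 =
      E (cs_mul (cs_star (j X)) (cs_mul (j f + k) (j X))) u0.
    rewrite cs_mulDl cs_mulDr -[X in _ = E (X + _) _]scale1r E_lin mul1r.
    by rewrite [in X in _ + X]cs_mulA Kk addr0.
  by apply: le_trans (E_compression _ _ _) _; rewrite X1 mulr1.
rewrite XE// in h1.
have h2 : `|phi f - \sum_(x \in S) f x * (\sum_(y <- w) xi (gmul x y) * xi y)%:C%C| <= (e / 2)%:C%C.
  rewrite /isotropy_sum (fsum_seqE uF)// (fsum_seqE uF)//; last first.
    by move=> x Sx xF; rewrite f0// mul0r.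
  rewrite -sumrB; apply: le_trans (ler_norm_sum _ _ _) _.
  apply: (@le_trans _ _ (M * (d / 2))%:C%C); last first.
    by rewrite lecR; apply/ltW/dP; rewrite ltr_pdivrMr// mulr2n mulrDr mulr1; lra.
  rewrite rmorphM /= rmorph_sum /= mulr_suml big_seq [leRHS]big_seq.
  apply: ler_sum => x xF; rewrite -[X in X - _]mulr1 -mulrBr normrM {1}nE.
  apply: ler_wpM2l; first by rewrite ler0c.
  rewrite -(rmorph1 (real_complex R)) -rmorphB /= normc_def /= expr0n addr0 sqrtr_sqr lecR.
  exact: xid.
have := ler_normD (phi f - \sum_(x \in S) f x * (\sum_(y <- w) xi (gmul x y) * xi y)%:C%C)
  (\sum_(x \in S) f x * (\sum_(y <- w) xi (gmul x y) * xi y)%:C%C).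
rewrite subrK => /le_trans; apply; apply: le_trans (lerD h2 h1) _.
rewrite (rnormE (j f + k)) (rnormE (q _)) -!rmorphD lecR /=.
by move: kq; lra.
Qed.

(** * The ideal of the reduced algebra defined by the isotropy sum *)

(** Once [phi] is bounded for the reduced norm, this is the kernel of its continuous extension,
    described as the closure of the image of the kernel of [phi] so that no extension has to be
    built. *)
Definition trivially_null (b : Cred) : Prop := forall e : R, 0 < e ->
  exists f, [/\ Cc f, phi f = 0 & rnorm (b - q (j f)) < e].

(** Same shape as [cond_exp_ideal]: multiplying on both sides turns the kernel of a functional into
    a two-sided ideal. *)
Definition kernel_ideal : set Cred :=
  [set b | forall c d, trivially_null (cs_mul (cs_mul c b) d)].

Lemma trivially_null0 : trivially_null 0.
Proof.
move=> e e0; exists (fun=> 0); split; first exact: Cc0.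
  by rewrite /isotropy_sum fsbig1.
have -> : j (fun=> 0) = 0.
  have := j_lin (-1) (Cc0 R G_hausdorff) (Cc0 R G_hausdorff).
  by under [X in j X]eq_fun do rewrite mulr0 addr0; rewrite scaleN1r addNr.
by have := q_B 0 0; rewrite !subrr => ->; rewrite subrr /rnorm normr0.
Qed.

Lemma trivially_null_closed b : (forall e : R, 0 < e ->
  exists2 b', trivially_null b' & rnorm (b - b') < e) -> trivially_null b.
Proof.
move=> H e e0; have e20 : 0 < e / 2 by rewrite divr_gt0.
have [b' nb' bb'] := H _ e20; have [f [Cf f0 fb]] := nb' _ e20.
exists f; split => //.
have := rnormD (b - b') (b' - q (j f)); rewrite addrA subrK; lra.
Qed.

Lemma trivially_null_lin (c : R[i]) b b' : trivially_null b -> trivially_null b' ->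
  trivially_null (c *: b + b').
Proof.
move=> nb nb' e e0; have e20 : 0 < e / 2 by rewrite divr_gt0.
have nE : `|c| = (complex.Re `|c|)%:C%C by rewrite RRe_real// normr_real.
have n0 : 0 <= complex.Re `|c| by rewrite -ler0c -nE.
have [d d0 dP] := pos_scale n0 e20.
have [f [Cf f0 fb]] := nb _ d0; have [g [Cg g0 gb]] := nb' _ e20.
exists (fun t => c * f t + g t); split.
- exact: Cc_lin.
- by rewrite isotropy_sum_lin// f0 g0 mulr0 addr0.
rewrite j_lin// q_lin opprD addrACA -scalerBr.
apply: le_lt_trans (rnormD _ _) _; rewrite [ltRHS]splitr; apply: ltrD => //.
have -> : rnorm (c *: (b - q (j f))) = complex.Re `|c| * rnorm (b - q (j f)).
  by apply: (@complexI R); rewrite rmorphM /= -!rnormE -nE normrZ.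
exact: dP.
Qed.

Lemma kernel_ideal_closed_ideal : closed_ideal kernel_ideal.
Proof.
split.
- move=> b clb c d; apply: trivially_null_closed => e e0.
  have [k k0 kP] := pos_scale (mulr_ge0 (rnorm_ge0 c) (rnorm_ge0 d)) e0.
  have [b' Jb' bb'] := closure_approx k0 clb.
  exists (cs_mul (cs_mul c b') d); first exact: Jb'.
  rewrite -cs_mulBl -cs_mulBr; apply: le_lt_trans (kP _ bb').
  apply: le_trans (rnorm_mul _ _) _; rewrite mulrAC.
  by apply: ler_wpM2r; [exact: rnorm_ge0|exact: rnorm_mul].
- by move=> c d; rewrite cs_mulr0 cs_mul0r; exact: trivially_null0.
- move=> x y Jx Jy c d; rewrite cs_mulDr cs_mulDl -[X in X + _]scale1r.
  exact: trivially_null_lin.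
- move=> a x Jx c d; rewrite cs_mulZr cs_mulZl -[_ *: _]addr0.
  by apply: trivially_null_lin => //; exact: trivially_null0.
- move=> a x Jx; split => c d.
    by rewrite cs_mulA; exact: Jx.
  by rewrite cs_mulA -cs_mulA; exact: Jx.
Qed.

(** For multipliers coming from [Cc] this is [bundle_defect_killed]; density then handles [c], and
    afterwards [d]. *)
Lemma kernel_ideal_bundle_defect (n : G -> cplx R) (V : set G) :
  bisection V -> V `<=` @IntIso G -> Cc n -> (forall z, ~ V z -> n z = 0) ->
  (forall z, (n z)^* = n z) -> kernel_ideal (q (j (bundle_defect n))).
Proof.
move=> Vb VI Cn n0 nr c d.
have Cb := Cc_bundle_defect G_hausdorff G_etale Cn.
set F := q _.
have step1 h : Cc h -> trivially_null (cs_mul (cs_mul c F) (q (j h))).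
  move=> Ch; apply: trivially_null_closed => e e0.
  have [k k0 kP] := pos_scale (rnorm_ge0 (cs_mul F (q (j h)))) e0.
  have [g Cg gc] := qj_dense c k0.
  exists (cs_mul (cs_mul (q (j g)) F) (q (j h))).
    move=> t t0; exists (conv (conv g (bundle_defect n)) h).
    have Cgb := Cc_conv G_hausdorff G_etale Cg Cb.
    split; [exact: Cc_conv|exact: (@bundle_defect_killed R G G_hausdorff G_etale u0 n V)|].
    by rewrite !j_conv// !q_mul subrr /rnorm normr0.
  rewrite -!cs_mulA -cs_mulBl; apply: le_lt_trans (kP _ gc).
  by rewrite mulrC; exact: rnorm_mul.
apply: trivially_null_closed => e e0.
have [k k0 kP] := pos_scale (rnorm_ge0 (cs_mul c F)) e0.
have [h Ch hd] := qj_dense d k0.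
exists (cs_mul (cs_mul c F) (q (j h))); first exact: step1.
by rewrite -cs_mulBr; apply: le_lt_trans (kP _ hd); exact: rnorm_mul.
Qed.

(** A bump function [n] on the units with value 1 at [u0] has a threefold product with [phi] equal
    to 1. Were [n] in the ideal, some [f] with [phi f = 0] would be at reduced distance less than 1
    from that product, against [isotropy_sum_le]. *)
Lemma kernel_ideal_proper : kernel_ideal != setT.
Proof.
apply/eqP => JT.
have := @bisection_bump R G G_locally_compact G_hausdorff G_etale (gunit u0 : G) (range (@gunit G)).
case; first by apply: open_nbhs_nbhs; split; [exact: open_range_gunit|exists u0].
move=> V [n [_ VU [Cn n0 _ nu]]].
have nU y : ~ range (@gunit G) y -> n y = 0 by move=> yU; apply: n0 => /VU.
have Cnn := Cc_conv G_hausdorff G_etale Cn Cn.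
have Cnnn := Cc_conv G_hausdorff G_etale Cnn Cn.
have : kernel_ideal (q (j n)) by rewrite JT.
move=> /(_ (q (j n)) (q (j n)) 1 ltr01) [f [Cf f0]].
rewrite -!q_mul -!j_conv// -q_B.
have -> : j (conv (conv n n) n) - j f = j (fun t => -1 * f t + conv (conv n n) n t).
  by rewrite j_lin// scaleN1r addrC.
have Cg : Cc (fun t => -1 * f t + conv (conv n n) n t) by exact: Cc_lin.
move=> h; have := isotropy_sum_le Cg; rewrite [leRHS]rnormE isotropy_sum_lin// f0 mulr0 add0r.
have unit1 : n (gunit u0) = 1 by rewrite nu ?eqxx.
have -> : phi (conv (conv n n) n) = 1.
  have Su : S (gunit u0) by split; [exact: IntIso_unit|exact: gsrc_unit].
  have nnU y : ~ range (@gunit G) y -> conv n n y = 0.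
    by move=> yU; rewrite conv_unit_rangel// (nU y)// mulr0.
  rewrite /isotropy_sum (fsum_seqE (r := [:: gunit u0]))//.
  - by rewrite big_seq1 !conv_unit_rangel// !grng_unit unit1 !mulr1.
  - by move=> x; rewrite inE => /eqP ->.
  - move=> x Sx; rewrite inE => xu; rewrite conv_unit_rangel// nU ?mulr0//.
    move=> [v _ e]; move: xu; rewrite -e -(IntIso_at_src Sx) -e gsrc_unit eqxx.
    by [].
by rewrite normr1 -(rmorph1 (real_complex R)) lecR leNgt h.
Qed.

Lemma kernel_ideal_nonzero (x : G) : IntIso x -> x != gunit (gsrc x) ->
  exists2 b, kernel_ideal b & b != 0.
Proof.
move=> Ix xu.
have [V [n [Vb VI [Cn n0 nr nx]]]] := @bisection_bump R G G_locally_compact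
  G_hausdorff G_etale x _ (open_nbhs_nbhs (conj (@open_IntIso G) Ix)).
have Cb := Cc_bundle_defect G_hausdorff G_etale Cn.
exists (q (j (bundle_defect n))); first exact: kernel_ideal_bundle_defect Vb VI Cn n0 nr.
apply/eqP => q0; have [_ _ K _] := q_quo.
have : cond_exp_ideal E (j (bundle_defect n)) by rewrite -K.
(* Testing membership in [cond_exp_ideal E] with [n^*] on the left and a bump [m] at the unit on the
   right isolates the value of the defect at [x], which is 1 because [x] is not a unit. *)
have [W [m [_ _ [Cm _ _ mu]]]] := @bisection_bump R G G_locally_compact
  G_hausdorff G_etale (gunit (gsrc x)) setT (@filterT _ _ (nbhs_filter _)).
rewrite gsrc_unit in mu.
move=> /(_ (cs_star (j n)) (j m)) /(congr1 (fun F => F (gsrc x))).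
rewrite -cs_mulA -j_conv// E_star_mul//; last exact: Cc_conv.
have nxx : n x = 1 by rewrite nx// eqxx.
rewrite (fsum_seqE (r := [:: x]))//; first last.
- by move=> b bx; rewrite inE => /negPf xb; rewrite nx// xb conjC0 mul0r.
- by move=> b; rewrite inE => /eqP ->.
rewrite big_seq1 nxx conjC1 mul1r convE (fsum_seqE (r := [:: gunit (gsrc x)]))//; first last.
- by move=> b bx; rewrite inE => /negPf xb; rewrite mu// xb mulr0.
- by move=> b; rewrite inE => /eqP ->; exact: gsrc_unit.
rewrite big_seq1 mu ?gsrc_unit// eqxx mulr1 ginv_unit gmul_unit.
have Vx : V x.
  by apply: contrapT => /n0; rewrite nxx => /eqP; rewrite oner_eq0.
rewrite (bundle_defect_fiber Vb n0 nr Vx)// nxx eqxx (negPf xu) subr0 !mulr1.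
by move/eqP; rewrite oner_eq0.
Qed.

End ReducedAlgebra.

Unset Implicit Arguments.

Theorem corollary7p9 (R : realType) (G : groupoid)
    (G_second_countable : @second_countable G)
    (G_locally_compact : locally_compact [set: G])
    (G_hausdorff : hausdorff_space G)
    (G_etale : etale G)
    (A : cstarAlgebra R) (j : (G -> cplx R) -> A)
    (E : A -> gobj G -> cplx R)
    (Cred : cstarAlgebra R) (q : A -> Cred)
    (Cred_spec : is_reduced_cstar j E q)
    (Cred_simple : simple_cstar Cred)
    (u0 : gobj G)
    (u0_amenable : amenable_isotropy R (IntIso_at u0)) :
  forall u : gobj G, IntIso_at u = [set gunit u].
Proof.
move=> u; apply/seteqP; split => [x [Ix xu] /=|_ ->]; last first.
  by split; [exact: IntIso_unit|exact: gsrc_unit].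
apply/eqP; apply: contraT => nxu.
have [j_full E_exp q_quo] := Cred_spec.
rewrite -xu in nxu.
have [b Jb b0] := kernel_ideal_nonzero G_locally_compact G_hausdorff G_etale
  j_full E_exp q_quo u0 Ix nxu.
have Jid := kernel_ideal_closed_ideal G_hausdorff G_etale j_full q_quo u0.
have [J0|JT] := Cred_simple _ Jid.
  by move: Jb; rewrite J0 /= => /eqP; rewrite (negPf b0).
have := kernel_ideal_proper G_locally_compact G_hausdorff G_etale j_full E_exp q_quo u0_amenable.
by rewrite JT eqxx.
Qed.
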